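(* Let $S$ be a finite nonempty set of primes, $l=\#S$, $d,m\ge1$, $n=d+m$. For each $\nu\in S$ let $\mathcal{U}_\nu\subseteq\mathbb{Z}_\nu^d$ be open, $\mathbf{f}_\nu:\mathcal{U}_\nu\to\mathbb{Z}_\nu^m$ a $C^2$ map, $\mathbf{F}_\nu(\mathbf{x})=(\mathbf{x},\mathbf{f}_\nu(\mathbf{x}))$, $\mathcal{M}_\nu=\mathbf{F}_\nu(\mathcal{U}_\nu)$, $\mathcal{U}=\prod_\nu\mathcal{U}_\nu$, $\mathcal{M}=\prod_\nu\mathcal{M}_\nu$, $\mathbf{F}((\mathbf{x}_\nu)_\nu)=(\mathbf{F}_\nu(\mathbf{x}_\nu))_\nu$. Let $\boldsymbol{\tau}=(\tau_{i,\nu})\in\mathbb{R}_+^{nl}$ satisfy (a) $\sum_{i,\nu}\tau_{i,\nu}=n+1$; (b) $\min_{1\le i\le d}\tau_{i,\nu}\ge\max_{1\le j\le m}\tau_{d+j,\nu}$ for all $\nu\in S$; (c) $\sum_{\nu\in S}\tau_{i,\nu}>1$ for all $1\le i\le n$. For $0<\alpha<\min\{\min_{\nu,i}\tau_{i,\nu},1\}$ and $\nu\in S$ define $\boldsymbol{\tau}^{\nu,\alpha}\in\mathbb{R}_+^{nl}$ by $$\tau^{\nu,\alpha}_{i,\nu}=\frac{(\tau_{i,\nu}-\alpha)(n+1)}{n+1-n\alpha},\qquad\tau^{\nu,\alpha}_{i,\sigma}=\frac{\tau_{i,\sigma}(n+1)}{n+1-n\alpha}\ (\sigma\in S\setminus\{\nu\}).$$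 Suppose there exists such an $\alpha$ for which, for every $\nu\in S$ with $\min_{1\le i\le n}\tau_{i,\nu}\le1$, $\omega_{\boldsymbol{\tau}^{\nu,\alpha}}(\mathcal{M})<1+\frac{\alpha}{(1-\alpha)(n+1)}$. Then $\mu_{S,d}\big(\mathbf{F}^{-1}(\mathbf{Bad}^{(S)}_n(\boldsymbol{\tau}))\big)=0$.
   Context: For a prime $\nu$, $\mathbb{Q}_\nu$ is the $\nu$-adic field with $|\nu|_\nu=\nu^{-1}$, $\mathbb{Z}_\nu=\{|x|_\nu\le1\}$; $C^2$ in the ultrametric sense. $\mathbb{Q}_S=\prod_{\nu\in S}\mathbb{Q}_\nu$, $\mathbb{Z}_S=\prod\mathbb{Z}_\nu$, $\mu_{S,k}$ Haar measure on $\mathbb{Q}_S^k$ with $\mu_{S,k}(\mathbb{Z}_S^k)=1$; points of $\mathbb{Q}_S^n$ are $\mathbf{y}=(y_{i,\nu})$. For $\tilde{\mathbf{b}}=(b_0,\dots,b_n)\in\mathbb{Z}^{n+1}$, $\|\tilde{\mathbf{b}}\|_\infty=\max_i|b_i|$. For $c>0$, $W(c;\boldsymbol{\tau})$ is the set of $\mathbf{y}\in\mathbb{Z}_S^n$ such that for infinitely many $\tilde{\mathbf{b}}$, $|b_0y_{i,\nu}-b_i|_\nu<c\|\tilde{\mathbf{b}}\|_\infty^{-\tau_{i,\nu}}$ for all $i,\nu$; $\mathbf{Bad}^{(S)}_n(\boldsymbol{\tau})=W(1;\boldsymbol{\tau})\setminus\bigcap_kW(\tfrac1k;\boldsymbol{\tau})$.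 For weights $\boldsymbol{\kappa}=(\kappa_{i,\nu})$ with positive entries summing to $n+1$ and $\mathbf{y}\in\mathbb{Q}_S^n$: $\omega_{\boldsymbol{\kappa}}(\mathbf{y})=\sup\{\omega:\max_{i,\nu}|b_0y_{i,\nu}+b_i|_\nu^{1/\kappa_{i,\nu}}\le\|\tilde{\mathbf{b}}\|_\infty^{-\omega}\text{ for infinitely many }\tilde{\mathbf{b}}\in\mathbb{Z}^{n+1}\}$, and $\omega_{\boldsymbol{\kappa}}(\mathcal{M})=\inf\{\omega:\omega_{\boldsymbol{\kappa}}(\mathbf{F}(\mathbf{x}))\le\omega\text{ for }\mu_{S,d}\text{-a.e. }\mathbf{x}\in\mathcal{U}\}$. *)

(* Defs.v *)
From HB Require Import structures.
From mathcomp Require Import all_boot all_order all_algebra finmap.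
From mathcomp Require Import fraction.
From mathcomp Require Import all_classical all_reals all_analysis.
Set Implicit Arguments.
Unset Strict Implicit.
Unset Printing Implicit Defensive.
Import Order.TTheory GRing.Theory Num.Theory.
Local Open Scope classical_set_scope.
Local Open Scope ring_scope.

Notation primeNat := {p : nat | prime p}.

(* [x n] is the canonical representative of x modulo p^n. *)
Definition coherent (p : primeNat) : set (nat -> nat) :=
  [set x | forall n, (x n.+1 %% val p ^ n)%N = x n].

(* Z_p is the inverse limit of the rings Z/p^n. *)
Record padic_int (p : primeNat) := PadicInt {
  residue :> nat -> nat;
  _ : `[< coherent p residue >]
}.

HB.instance Definition _ p := [isSub for @residue p].
HB.instance Definition _ p := [Choice of padic_int p by <:].

Section PadicInt.
Local Open Scope nat_scope.
Variable p : primeNat.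
Local Notation q := (val p).
Implicit Types x y z : padic_int p.

Lemma prime_q : prime q. Proof. exact: valP. Qed.

Lemma q_gt1 : 1 < q. Proof. exact/prime_gt1/prime_q. Qed.

Lemma expq_gt0 n : 0 < q ^ n.
Proof. by rewrite expn_gt0 prime_gt0 // prime_q. Qed.

Lemma residueP x n : x n.+1 %% q ^ n = x n.
Proof. by case: x => x /= /asboolP; apply. Qed.

Lemma residue_lt x n : x n < q ^ n.
Proof. by rewrite -residueP ltn_mod expq_gt0. Qed.

Lemma residue_small x n : x n %% q ^ n = x n.
Proof. by rewrite modn_small ?residue_lt. Qed.

Lemma residue_mod x k n : k <= n -> x n %% q ^ k = x k.
Proof.
elim: n => [|n IHn]; first by rewrite leqn0 => /eqP->; rewrite residue_small.
rewrite leq_eqVlt => /predU1P[->|kn]; first by rewrite residue_small.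
by rewrite -(IHn kn) -(residueP x n) modn_dvdm // dvdn_exp2l.
Qed.

Lemma residue_inj x y : (forall n, x n = y n) -> x = y.
Proof. by move=> xy; apply/val_inj/funext. Qed.

Lemma modn_expS n m : (m %% q ^ n.+1) %% q ^ n = m %% q ^ n.
Proof. by rewrite modn_dvdm // dvdn_exp2l. Qed.

Fact nat_coherent k : `[< coherent p (fun n => k %% q ^ n) >].
Proof. by apply/asboolP => n; rewrite modn_expS. Qed.
Definition padic_int_nat k : padic_int p := PadicInt (nat_coherent k).

Fact add_coherent x y : `[< coherent p (fun n => (x n + y n) %% q ^ n) >].
Proof. by apply/asboolP => n; rewrite modn_expS -modnDm !residueP. Qed.
Definition padic_int_add x y : padic_int p := PadicInt (add_coherent x y).

Fact opp_coherent x : `[< coherent p (fun n => (q ^ n - x n) %% q ^ n) >].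
Proof.
apply/asboolP => n; rewrite modn_expS; apply/eqP.
rewrite -(eqn_modDr (x n)) subnK; last exact/ltnW/residue_lt.
rewrite -(residueP x n) modnDmr subnK; last exact/ltnW/residue_lt.
by rewrite modnn; apply/eqP/eqP; rewrite -/(dvdn _ _) dvdn_exp2l.
Qed.
Definition padic_int_opp x : padic_int p := PadicInt (opp_coherent x).

Fact mul_coherent x y : `[< coherent p (fun n => (x n * y n) %% q ^ n) >].
Proof. by apply/asboolP => n; rewrite modn_expS -modnMm !residueP. Qed.
Definition padic_int_mul x y : padic_int p := PadicInt (mul_coherent x y).

Fact padic_int_addA : associative padic_int_add.
Proof.
by move=> x y z; apply: residue_inj => n /=; rewrite modnDml modnDmr addnA.
Qed.

Fact padic_int_addC : commutative padic_int_add.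
Proof. by move=> x y; apply: residue_inj => n /=; rewrite addnC. Qed.

Fact padic_int_add0 : left_id (padic_int_nat 0) padic_int_add.
Proof.
by move=> x; apply: residue_inj => n /=; rewrite modnDml residue_small.
Qed.

Fact padic_int_addN : left_inverse (padic_int_nat 0) padic_int_opp padic_int_add.
Proof.
move=> x; apply: residue_inj => n /=.
by rewrite modnDml subnK ?modnn ?mod0n //; exact/ltnW/residue_lt.
Qed.

HB.instance Definition _ := GRing.isZmodule.Build (padic_int p)
  padic_int_addA padic_int_addC padic_int_add0 padic_int_addN.

Fact padic_int_mulA : associative padic_int_mul.
Proof.
by move=> x y z; apply: residue_inj => n /=; rewrite modnMml modnMmr mulnA.
Qed.

Fact padic_int_mulC : commutative padic_int_mul.
Proof. by move=> x y; apply: residue_inj => n /=; rewrite mulnC. Qed.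

Fact padic_int_mul1 : left_id (padic_int_nat 1) padic_int_mul.
Proof.
by move=> x; apply: residue_inj => n /=; rewrite modnMml mul1n residue_small.
Qed.

Fact padic_int_mulDl : left_distributive padic_int_mul padic_int_add.
Proof.
by move=> x y z; apply: residue_inj => n /=; rewrite modnMml modnDm mulnDl.
Qed.

Fact padic_int_1neq0 : padic_int_nat 1 != padic_int_nat 0.
Proof.
apply/eqP => /(congr1 (fun x : padic_int p => x 1)) /=.
by rewrite expn1 mod0n modn_small // q_gt1.
Qed.

HB.instance Definition _ := GRing.Zmodule_isComNzRing.Build (padic_int p)
  padic_int_mulA padic_int_mulC padic_int_mul1 padic_int_mulDl padic_int_1neq0.

Lemma residue0 n : (0%R : padic_int p) n = 0. Proof. exact: mod0n. Qed.

Lemma residueD x y n : (x + y)%R n = (x n + y n) %% q ^ n. Proof. by []. Qed.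

Lemma residueM x y n : (x * y)%R n = (x n * y n) %% q ^ n. Proof. by []. Qed.

Lemma residue_nat k n : (k%:R%R : padic_int p) n = k %% q ^ n.
Proof.
elim: k => [|k IHk]; first by rewrite mulr0n residue0 mod0n.
by rewrite mulrS residueD IHk modnDm add1n.
Qed.

Lemma residue_neq0 x : x != 0%R -> exists n, x n != 0.
Proof.
move=> x0; apply/not_existsP => xn0; case/eqP: x0.
by apply: residue_inj => n; rewrite residue0; apply/eqP/negPn/negP/xn0.
Qed.

Lemma logn_residue_lt x n : x n != 0 -> logn q (x n) < n.
Proof.
move=> xn; rewrite -(ltn_exp2l _ _ q_gt1) (leq_ltn_trans _ (residue_lt x n)) //.
by apply: dvdn_leq; rewrite ?lt0n // pfactor_dvdnn.
Qed.

(* [logn q (x n)] does not depend on n as soon as [x n] is nonzero. *)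
Lemma logn_residue x k n : x k != 0 -> k <= n -> logn q (x n) = logn q (x k).
Proof.
move=> xk kn; have xn : x n != 0.
  by apply: contraNneq xk => xn; rewrite -(residue_mod x kn) xn mod0n.
apply/eqP; rewrite eqn_leq; apply/andP; split.
- have nlt : logn q (x n) < k.
    rewrite ltnNge; apply: contra xk => le; rewrite -(residue_mod x kn).
    by rewrite -/(dvdn _ _) pfactor_dvdn ?prime_q ?lt0n.
  rewrite -(pfactor_dvdn _ prime_q) ?lt0n // -(residue_mod x kn).
  by rewrite /dvdn modn_dvdm ?dvdn_exp2l 1?ltnW // -/(dvdn _ _)
     (pfactor_dvdn _ prime_q) ?lt0n.
- have klt := logn_residue_lt xk.
  rewrite -(pfactor_dvdn _ prime_q) ?lt0n // /dvdn.
  rewrite -(modn_dvdm _ (dvdn_exp2l q (ltnW klt))) (residue_mod x kn).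
  exact: pfactor_dvdnn.
Qed.

Lemma residueM_neq0 x y k l : x k != 0 -> y l != 0 ->
  (x * y)%R (k + l) != 0 /\
  logn q ((x * y)%R (k + l)) = logn q (x k) + logn q (y l).
Proof.
move=> xk yl.
have lex := logn_residue xk (leq_addr l k).
have ley := logn_residue yl (leq_addl k l).
have xn : x (k + l) != 0.
  apply: contraNneq xk => xn.
  by rewrite -(residue_mod x (leq_addr l k)) xn mod0n.
have yn : y (k + l) != 0.
  apply: contraNneq yl => yn.
  by rewrite -(residue_mod y (leq_addl k l)) yn mod0n.
have lM : logn q (x (k + l) * y (k + l)) = logn q (x k) + logn q (y l).
  by rewrite lognM ?lt0n // lex ley.
have lt : logn q (x k) + logn q (y l) < k + l.
  by rewrite -addSn leq_add ?logn_residue_lt // ltnW // logn_residue_lt.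
have M0 : 0 < x (k + l) * y (k + l) by rewrite muln_gt0 !lt0n xn.
have nz : (x * y)%R (k + l) != 0.
  rewrite residueM -/(dvdn _ _) (pfactor_dvdn _ prime_q) //.
  by rewrite lM -ltnNge.
split=> //; rewrite -lM; apply/eqP; rewrite eqn_leq; apply/andP; split.
- rewrite -(pfactor_dvdn _ prime_q) //.
  have llt := ltnW (logn_residue_lt nz).
  by rewrite /dvdn -(modn_dvdm _ (dvdn_exp2l q llt)) -residueM;
    exact: pfactor_dvdnn.
- rewrite -(pfactor_dvdn _ prime_q) ?lt0n // residueM /dvdn modn_dvdm.
    exact: pfactor_dvdnn.
  by rewrite dvdn_exp2l // lM ltnW.
Qed.

Definition padic_int_unit : {pred padic_int p} :=
  fun x => `[< exists y, (y * x)%R = 1%R >].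

Definition padic_int_inv x :=
  if pselect (exists y, (y * x)%R = 1%R) is left e then projT1 (cid e) else x.

Fact padic_int_mulVx :
  {in padic_int_unit, left_inverse 1%R padic_int_inv *%R}.
Proof.
move=> x /asboolP ex; rewrite /padic_int_inv; case: pselect => // e.
by case: cid.
Qed.

Fact padic_int_unitPl x y : (y * x)%R = 1%R -> padic_int_unit x.
Proof. by move=> yx; apply/asboolP; exists y. Qed.

Fact padic_int_invr_out : {in [predC padic_int_unit], padic_int_inv =1 id}.
Proof.
move=> x; rewrite inE => /asboolPn nx; rewrite /padic_int_inv.
by case: pselect.
Qed.

HB.instance Definition _ := GRing.ComNzRing_hasMulInverse.Build (padic_int p)
  padic_int_mulVx padic_int_unitPl padic_int_invr_out.

Fact padic_int_integral x y : (x * y = 0 -> (x == 0) || (y == 0))%R.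
Proof.
move=> xy; apply/negPn; rewrite negb_or; apply/negP.
move=> /andP[/residue_neq0[k xk] /residue_neq0[l yl]].
by have [] := residueM_neq0 xk yl; rewrite xy residue0.
Qed.

HB.instance Definition _ :=
  GRing.ComUnitRing_isIntegral.Build (padic_int p) padic_int_integral.

End PadicInt.

Section PadicIntNorm.
Variable p : primeNat.
Local Notation q := (val p).
Implicit Types x y z : padic_int p.

(* If [x n] is nonzero, then [logn q (x n)] is the p-adic valuation of x. *)
Definition padic_int_norm x : rat :=
  if pselect (exists n, x n != 0%N) is left nz
  then q%:R ^- logn q (x (ex_minn nz)) else 0.

Lemma padic_int_normE x n : x n != 0%N -> padic_int_norm x = q%:R ^- logn q (x n).
Proof.
move=> xn; rewrite /padic_int_norm; case: pselect => [nz|[]]; last by exists n.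
case: ex_minnP => k xk /(_ _ xn) kn.
by rewrite (logn_residue xk kn).
Qed.

Lemma padic_int_norm0 : padic_int_norm 0 = 0.
Proof.
rewrite /padic_int_norm; case: pselect => // nz; exfalso.
by case: nz => n; rewrite residue0.
Qed.

Lemma q_gt0 : 0 < q%:R :> rat.
Proof. by rewrite ltr0n prime_gt0 // prime_q. Qed.

Lemma padic_int_norm_gt0 x : x != 0 -> 0 < padic_int_norm x.
Proof.
move=> /residue_neq0[n xn]; rewrite (padic_int_normE xn).
by rewrite invr_gt0 exprn_gt0 // q_gt0.
Qed.

Lemma padic_int_normM x y :
  padic_int_norm (x * y) = padic_int_norm x * padic_int_norm y.
Proof.
have [->|/residue_neq0[k xk]] := eqVneq x 0.
  by rewrite mul0r padic_int_norm0 mul0r.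
have [->|/residue_neq0[l yl]] := eqVneq y 0.
  by rewrite mulr0 padic_int_norm0 mulr0.
have [xy lxy] := residueM_neq0 xk yl.
rewrite (padic_int_normE xk) (padic_int_normE yl) (padic_int_normE xy) lxy.
by rewrite exprD invfM.
Qed.

Lemma padic_int_norm_le x n : (padic_int_norm x <= q%:R ^- n) = (x n == 0%N).
Proof.
have q1 : 1 < q%:R :> rat by rewrite ltr1n q_gt1.
have [xn|xn] := eqVneq (x n) 0%N; last first.
  apply/negbTE; rewrite -ltNge (padic_int_normE xn).
  by rewrite ltf_pV2 ?posrE ?exprn_gt0 ?q_gt0 // ltr_eXn2l // logn_residue_lt.
have [->|/residue_neq0[k xk]] := eqVneq x 0.
  by rewrite padic_int_norm0 invr_ge0 exprn_ge0 // ltW // q_gt0.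
have nk : (n <= k)%N.
  rewrite leqNgt; apply: contraNN xk => /ltnW kn.
  by rewrite -(residue_mod x kn) xn mod0n.
rewrite (padic_int_normE xk) lef_pV2 ?posrE ?exprn_gt0 ?q_gt0 //.
rewrite ler_eXn2l // -(pfactor_dvdn _ (prime_q p)) ?lt0n //.
by rewrite /dvdn residue_mod // xn.
Qed.

Lemma padic_int_normN x : padic_int_norm (- x) = padic_int_norm x.
Proof.
have n1 : padic_int_norm (-1) ^+ 2 = 1.
  rewrite expr2 -padic_int_normM mulrNN mulr1.
  rewrite (@padic_int_normE 1 1) /= expn1 modn_small ?q_gt1 //.
  by rewrite logn1 expr0 invr1.
rewrite -mulN1r padic_int_normM.
suff -> : padic_int_norm (-1) = 1 by rewrite mul1r.
apply/eqP; rewrite -(@eqrXn2 _ 2%N) ?n1 ?expr1n ?ler01 //.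
by rewrite ltW // padic_int_norm_gt0 // oppr_eq0 oner_eq0.
Qed.

Lemma padic_int_normD x y :
  padic_int_norm (x + y) <= Num.max (padic_int_norm x) (padic_int_norm y).
Proof.
wlog xy : x y / padic_int_norm x <= padic_int_norm y.
  move=> h; case/orP: (le_total (padic_int_norm x) (padic_int_norm y)) => [/h//|].
  by move/h; rewrite addrC maxC.
rewrite maxEle xy.
have [y0|/residue_neq0[n yn]] := eqVneq y 0.
  suff -> : x = 0 by rewrite add0r.
  apply: contraTeq xy => /padic_int_norm_gt0.
  by rewrite y0 padic_int_norm0 -ltNge.
move: xy; set k := logn q (y n); have ny := padic_int_normE yn.
rewrite ny padic_int_norm_le => /eqP xk.
have : padic_int_norm y <= q%:R ^- k by rewrite ny.
rewrite !padic_int_norm_le residueD => /eqP yk.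
by rewrite xk yk mod0n.
Qed.

End PadicIntNorm.

Definition padic (p : primeNat) := {fraction padic_int p}.
HB.instance Definition _ p := GRing.Field.on (padic p).

Notation "''Q_[' p ]" := (padic p) (format "''Q_[' p ]") : type_scope.

Section Padic.
Variable p : primeNat.
Local Notation q := (val p).
Implicit Types x y z : 'Q_[p].

Definition padic_norm x : rat :=
  padic_int_norm (frac (repr x)).1 / padic_int_norm (frac (repr x)).2.

Lemma padic_fracE x :
  x = FracField.tofrac (frac (repr x)).1 / FracField.tofrac (frac (repr x)).2.
Proof.
apply: (canRL (mulfK _)); first by rewrite tofrac_eq0 denom_ratioP.
rewrite -[X in X * _]reprK; unlock FracField.tofrac.
rewrite -[LHS]FracField.pi_mul; apply/eqmodP => /=.
rewrite FracField.equivfE /FracField.mulf.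
rewrite !numden_Ratio ?mulf_neq0 ?oner_eq0 ?denom_ratioP //.
by rewrite !mulr1 mulrC.
Qed.

Lemma padic_norm_frac (a b : padic_int p) : b != 0 ->
  padic_norm (FracField.tofrac a / FracField.tofrac b) =
  padic_int_norm a / padic_int_norm b.
Proof.
move=> b0; set x := (X in padic_norm X); rewrite /padic_norm.
set n := (frac (repr x)).1; set d := (frac (repr x)).2.
have d0 : d != 0 by exact: denom_ratioP.
have nd : padic_int_norm d != 0 by rewrite gt_eqF // padic_int_norm_gt0.
have nb : padic_int_norm b != 0 by rewrite gt_eqF // padic_int_norm_gt0.
have : FracField.tofrac (n * b) = FracField.tofrac (a * d).
  apply/eqP; rewrite !tofracM -eqr_div ?tofrac_eq0 //.
  by apply/eqP/esym; exact: padic_fracE.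
move/eqP; rewrite tofrac_eq => /eqP /(congr1 (@padic_int_norm p)).
by rewrite !padic_int_normM => /eqP; rewrite -eqr_div // => /eqP.
Qed.

Lemma padic_norm0 : padic_norm 0 = 0.
Proof.
by rewrite -[0](mul0r (FracField.tofrac 1)^-1) -[X in X / _]tofrac0
  padic_norm_frac ?oner_eq0 // padic_int_norm0 mul0r.
Qed.

Lemma padic_norm_gt0 x : x != 0 -> 0 < padic_norm x.
Proof.
rewrite [X in X != 0]padic_fracE mulf_eq0 invr_eq0 !tofrac_eq0.
by rewrite negb_or => /andP[? ?]; rewrite divr_gt0 // padic_int_norm_gt0.
Qed.

Lemma padic_norm_ge0 x : 0 <= padic_norm x.
Proof.
by have [->|/padic_norm_gt0/ltW//] := eqVneq x 0; rewrite padic_norm0.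
Qed.

Lemma padic_norm_eq0 x : padic_norm x = 0 -> x = 0.
Proof.
by move=> /eqP nx; apply: contraTeq nx => /padic_norm_gt0; rewrite lt0r => /andP[].
Qed.

Lemma padic_normM x y : padic_norm (x * y) = padic_norm x * padic_norm y.
Proof.
rewrite {1}(padic_fracE x) {1}(padic_fracE y) mulf_div -!tofracM.
by rewrite padic_norm_frac ?mulf_neq0 ?denom_ratioP // !padic_int_normM -mulf_div.
Qed.

Lemma padic_normN x : padic_norm (- x) = padic_norm x.
Proof.
rewrite {1}(padic_fracE x) -mulNr -tofracN padic_norm_frac ?denom_ratioP //.
by rewrite padic_int_normN.
Qed.

Lemma padic_normD x y :
  padic_norm (x + y) <= Num.max (padic_norm x) (padic_norm y).
Proof.
set a := (frac (repr x)).1; set b := (frac (repr x)).2.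
set c := (frac (repr y)).1; set d := (frac (repr y)).2.
have b0 : b != 0 by exact: denom_ratioP.
have d0 : d != 0 by exact: denom_ratioP.
have nb : padic_int_norm b != 0 by rewrite gt_eqF // padic_int_norm_gt0.
have nd : padic_int_norm d != 0 by rewrite gt_eqF // padic_int_norm_gt0.
have -> : x + y = FracField.tofrac (a * d + c * b) / FracField.tofrac (b * d).
  rewrite tofracD !tofracM -addf_div ?tofrac_eq0 //.
  by rewrite -!padic_fracE.
rewrite padic_norm_frac ?mulf_neq0 // padic_int_normM.
rewrite ler_pdivrMr; last by rewrite mulr_gt0 // padic_int_norm_gt0.
apply: (le_trans (padic_int_normD _ _)).
have bd0 : 0 <= padic_int_norm b * padic_int_norm d.
  by rewrite ltW // mulr_gt0 // padic_int_norm_gt0.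
rewrite maxr_pMl // !padic_int_normM /padic_norm -/a -/b -/c -/d.
have -> : padic_int_norm a / padic_int_norm b
    * (padic_int_norm b * padic_int_norm d) =
    padic_int_norm a * padic_int_norm d by rewrite mulrA divfK.
have -> : padic_int_norm c / padic_int_norm d
    * (padic_int_norm b * padic_int_norm d) =
    padic_int_norm c * padic_int_norm b.
  by rewrite (mulrC (padic_int_norm b)) mulrA divfK.
by [].
Qed.

Lemma padic_norm_p : padic_norm q%:R = q%:R^-1.
Proof.
have q2 : (q%:R : padic_int p) 2%N = q.
  by rewrite residue_nat modn_small // -[X in (X < _)%N]expn1 ltn_exp2l // q_gt1.
have q0 : (q%:R : padic_int p) 2%N != 0%N.
  by rewrite q2 -lt0n prime_gt0 // prime_q.
have o1 : (1 : padic_int p) 1%N = 1%N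
  by rewrite -[1]mulr1n residue_nat modn_small // expn1 q_gt1.
rewrite -[q%:R]divr1 -tofrac1 -(rmorph_nat (@FracField.tofrac _)).
rewrite padic_norm_frac ?oner_eq0 // (padic_int_normE q0) q2.
rewrite (@padic_int_normE _ 1 1) o1 // logn1 expr0 invr1 divr1.
by rewrite logn_prime ?eqxx ?expr1 // prime_q.
Qed.

Definition padic_dist x y := padic_norm (x - y).

Fact padic_distxx x : padic_dist x x = 0.
Proof. by rewrite /padic_dist subrr padic_norm0. Qed.

Fact padic_dist_positivity x y : padic_dist x y = 0 -> x = y.
Proof. by move=> /padic_norm_eq0/eqP; rewrite subr_eq0 => /eqP. Qed.

Fact padic_dist_sym x y : padic_dist x y = padic_dist y x.
Proof. by rewrite /padic_dist -padic_normN opprB. Qed.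

Fact padic_dist_triangle y x z :
  padic_dist x z <= padic_dist x y + padic_dist y z.
Proof.
rewrite /padic_dist -(subrKA y) (le_trans (padic_normD _ _)) //.
by rewrite ge_max lerDl lerDr !padic_norm_ge0.
Qed.

HB.instance Definition _ := isMetric.Build rat 'Q_[p]
  padic_distxx padic_dist_positivity padic_dist_sym padic_dist_triangle.
HB.instance Definition _ := isPointed.Build 'Q_[p] 0.

End Padic.

Section DifferenceQuotients.
Variable p : primeNat.
Local Notation K := 'Q_[p].

(* The difference quotient of order [size s] of h at the points x :: s:
   Phi^0 h (x) = h x and
   Phi^k h (x1, x2, x3, ...) =
     (Phi^(k-1) h (x1, x3, ...) - Phi^(k-1) h (x2, x3, ...)) / (x1 - x2). *)
Fixpoint diff_quot (V : lmodType K) (h : K -> V) (x : K) (s : seq K) : V :=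
  if s is y :: s' then (x - y)^-1 *: (diff_quot h x s' - diff_quot h y s')
  else h x.

(* The difference quotient of order k of g with respect to the i-th variable,
   at the points [s 0 0, ..., s 0 k], the other variables being given by v. *)
Definition diff_quot_at (V : lmodType K) d (i : 'I_d) k (s : 'rV[K]_k.+1)
    (g : 'rV[K]_d -> V) (v : 'rV[K]_d) : V :=
  diff_quot (fun t => g (\row_j if j == i then t else v 0 j))
    (s 0 ord0) [seq s 0 (lift ord0 j) | j <- enum 'I_k].

(* Phi_beta f = Phi_0^(beta 0) (Phi_1^(beta 1) (... f)). All the variables are
   substituted in turn, so that the starting value 0 is irrelevant. *)
Definition multi_diff_quot (V : lmodType K) d (beta : 'I_d -> nat)
    (f : 'rV[K]_d -> V) (x : prod_topology (fun i => 'rV[K]_(beta i).+1)) : V :=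
  foldr (fun i => diff_quot_at i (x i)) f (enum 'I_d) 0.

(* The families x for which the grid formed by the points
   (x_0,j_0, ..., x_(d-1),j_(d-1)) lies in U. When U is a product of the U_i,
   this is the product of the U_i^(beta i + 1). *)
Definition grid d (beta : 'I_d -> nat) (U : set 'rV[K]_d) :
    set (prod_topology (fun i => 'rV[K]_(beta i).+1)) :=
  [set x | forall J : (forall i, 'I_(beta i).+1), U (\row_i x i 0 (J i))].

(* C^k in the sense of Schikhof and of Kleinbock and Tomanov: each difference
   quotient of total order at most k extends continuously to the whole grid.
   Only the values of f on the open set U matter. *)
Definition class_C (k d m : nat) (U : set 'rV[K]_d)
    (f : 'rV[K]_d -> 'rV[K]_m) : Prop :=
  forall beta : 'I_d -> nat, (\sum_i beta i <= k)%N ->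
  exists g : prod_topology (fun i => 'rV[K]_(beta i).+1) -> 'rV[K]_m,
    {within grid U, continuous g} /\
    forall x, grid U x -> (forall i, injective (x i 0)) ->
      g x = multi_diff_quot f x.

End DifferenceQuotients.

(* y_(i, nu) is [y nu 0 i]. *)
Definition QS (S : {fset primeNat}) (k : nat) :=
  prod_topology (fun nu : S => 'rV['Q_[val nu]]_k).

Definition ZS (S : {fset primeNat}) (k : nat) : set (QS S k) :=
  [set y | forall nu i, padic_norm (y nu 0 i) <= 1].

Definition QS_add (S : {fset primeNat}) (k : nat) (x y : QS S k) : QS S k :=
  fun nu => x nu + y nu.

Definition borelQS (S : {fset primeNat}) (k : nat) :=
  g_sigma_algebraType (@open (QS S k)).

(* The Haar measure on Q_S^k giving measure 1 to Z_S^k. *)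
Definition normalized_haar (R : realType) (S : {fset primeNat}) (k : nat)
    (mu : {measure set (borelQS S k) -> \bar R}) : Prop :=
  (forall (x : QS S k) (A : set (borelQS S k)), measurable A ->
     mu (QS_add x @` A) = mu A) /\
  mu (@ZS S k) = 1%E.

Section Approximation.
Variables (R : realType) (S : {fset primeNat}).

Definition padic_abs (p : primeNat) (x : 'Q_[p]) : R := ratr (padic_norm x).

Definition height (N : nat) (b : 'rV[int]_N) : R :=
  (\max_(i < N) `|b 0%R i|%N)%:R.

Section Dimension.
Variable n : nat.

Definition W (c : R) (tau : 'I_n -> S -> R) : set (QS S n) :=
  [set y | ZS y /\ infinite_set [set b : 'rV[int]_n.+1 |
    forall i nu, padic_abs ((b 0 ord0)%:~R * y nu 0 i - (b 0 (lift ord0 i))%:~R)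
      < c * height b `^ (- tau i nu)]].

Definition Bad (tau : 'I_n -> S -> R) : set (QS S n) :=
  W 1 tau `\` \bigcap_k W k.+1%:R^-1 tau.

Definition exponent (kappa : 'I_n -> S -> R) (y : QS S n) : \bar R :=
  ereal_sup [set w%:E | w in [set w : R | infinite_set
    [set b : 'rV[int]_n.+1 |
      \big[Num.max/0]_(i < n) \big[Num.max/0]_(nu : S)
        padic_abs ((b 0 ord0)%:~R * y nu 0 i + (b 0 (lift ord0 i))%:~R)
          `^ (kappa i nu)^-1
      <= height b `^ (- w)]]].

Definition shifted_weight (tau : 'I_n -> S -> R) (nu : S) (alpha : R) :
    'I_n -> S -> R :=
  fun i sigma =>
    if sigma == nu
    then (tau i nu - alpha) * n.+1%:R / (n.+1%:R - n%:R * alpha)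
    else tau i sigma * n.+1%:R / (n.+1%:R - n%:R * alpha).

End Dimension.

Section Manifold.
Variables d m : nat.
Variable f : forall nu : S, 'rV['Q_[val nu]]_d -> 'rV['Q_[val nu]]_m.

Definition graph_map (x : QS S d) : QS S (d + m) :=
  fun nu => row_mx (x nu) (f (x nu)).

Definition domain_prod (U : forall nu : S, set 'rV['Q_[val nu]]_d) :
    set (QS S d) :=
  [set x | forall nu, U nu (x nu)].

Definition manifold_exponent (mu : {measure set (borelQS S d) -> \bar R})
    (U : set (QS S d)) (kappa : 'I_(d + m) -> S -> R) : \bar R :=
  ereal_inf [set w%:E | w in [set w : R |
    {ae mu, forall x, U x -> (exponent kappa (graph_map x) <= w%:E)%E}]].

End Manifold.

End Approximation.

(* Main.v *)
Require Import Defs.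
From HB Require Import structures.
From mathcomp Require Import all_boot all_order all_algebra finmap.
From mathcomp Require Import fraction zify ring lra.
From mathcomp Require Import all_classical all_reals all_analysis.
Set Implicit Arguments.
Unset Strict Implicit.
Unset Printing Implicit Defensive.
Import Order.TTheory GRing.Theory Num.Theory.
Local Open Scope classical_set_scope.
Local Open Scope ring_scope.

(* In fact almost every x in U has F x in W c tau for every c > 0.

   Fix x and write b / b_0 for the point of Q_S^d with coordinates b_k / b_0.
   The pigeonhole principle, applied to the forms b_0 x_k - b_k and to the
   tangential forms b_0 f_j(x) - b_(d+j) - \sum_k D_kj (b_0 x_k - b_k), where D is
   the derivative of f at x, yields infinitely many b for which the former are at
   most A ||b||^(-tau) and the latter at most eps ||b||^(-tau), with eps as small
   as desired and A depending on eps.  As f (b / b_0) is approximated by the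
   tangent map at x, the whole box with centre b / b_0 and radii
   delta ||b||^(-tau) / |b_0| then consists of points z with
   |b_0 F_i(z) - b_i| < c ||b||^(-tau), while x lies in the concentric box with
   radii A ||b||^(-tau) / |b_0|.  The radii tend to 0: hypothesis (c) gives b_0 <> 0; if
   all tau_(i, nu) > 1, use |b_0|_nu >= 1 / ||b||; otherwise |b_0|_nu <
   ||b||^(-alpha) would force a large power of nu to divide b, and dividing it out
   would contradict the bound on the exponent.

   It remains to pass from the large boxes to the small ones.  Shapes of boxes are
   not nested, but enlarging a family of boxes in a single coordinate by a factor
   q multiplies the measure of the union by at most q, since on lines in that
   direction any two balls are nested or disjoint.  Doing so in each coordinate in
   turn replaces the Lebesgue density theorem. *)

(** * p-adic absolute values *)

Section PadicAbs.
Variables (R : realType) (p : primeNat).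
Local Notation q := (val p).
Local Notation abs := (@padic_abs R p).
Implicit Types x y z : 'Q_[p].

Lemma padic_absE x : abs x = ratr (padic_norm x). Proof. by []. Qed.

Lemma padic_abs_le1 x : (abs x <= 1) = (padic_norm x <= 1).
Proof. by rewrite padic_absE -(rmorph1 (ratr : rat -> R)) ler_rat. Qed.

Lemma padic_abs0 : abs 0 = 0. Proof. by rewrite padic_absE padic_norm0 rmorph0. Qed.

Lemma padic_abs_ge0 x : 0 <= abs x.
Proof. by rewrite padic_absE ler0q padic_norm_ge0. Qed.

Lemma padic_abs_gt0 x : (0 < abs x) = (x != 0).
Proof.
rewrite padic_absE ltr0q; have [->|/padic_norm_gt0 //] := eqVneq x 0.
by rewrite padic_norm0 ltxx.
Qed.

Lemma padic_abs_eq0 x : (abs x == 0) = (x == 0).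
Proof. by apply/negb_inj; rewrite -padic_abs_gt0 lt0r padic_abs_ge0 andbT. Qed.

Lemma padic_absM x y : abs (x * y) = abs x * abs y.
Proof. by rewrite !padic_absE padic_normM rmorphM. Qed.

Lemma padic_absN x : abs (- x) = abs x.
Proof. by rewrite !padic_absE padic_normN. Qed.

Lemma padic_absBC x y : abs (x - y) = abs (y - x).
Proof. by rewrite -padic_absN opprB. Qed.

Lemma padic_abs1 : abs 1 = 1.
Proof.
have := padic_absM 1 1; rewrite mulr1 => /eqP.
rewrite -{1}[abs 1]mulr1 eq_sym => /eqP/mulfI -> //.
by rewrite padic_abs_eq0 oner_eq0.
Qed.

Lemma padic_absV x : abs x^-1 = (abs x)^-1.
Proof.
have [->|x0] := eqVneq x 0; first by rewrite invr0 padic_abs0 invr0.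
apply: (mulfI (x := abs x)); first by rewrite padic_abs_eq0.
by rewrite -padic_absM !divff ?padic_abs_eq0 // padic_abs1.
Qed.

Lemma padic_absD_le r x y : abs x <= r -> abs y <= r -> abs (x + y) <= r.
Proof.
rewrite !padic_absE => xr yr.
apply: (@le_trans _ _ (ratr (Num.max (padic_norm x) (padic_norm y)))).
  by rewrite ler_rat padic_normD.
by rewrite maxEle; case: ifP.
Qed.

Lemma padic_absB_le r x y : abs x <= r -> abs y <= r -> abs (x - y) <= r.
Proof. by move=> xr yr; apply: padic_absD_le; rewrite ?padic_absN. Qed.

Lemma padic_absD_lt r x y : abs x < r -> abs y < r -> abs (x + y) < r.
Proof.
move=> xr yr.
have : abs (x + y) <= Num.max (abs x) (abs y).
  by apply: padic_absD_le; rewrite le_max lexx ?orbT.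
by move=> /le_lt_trans; apply; rewrite gt_max xr.
Qed.

Lemma padic_absB_lt r x y : abs x < r -> abs y < r -> abs (x - y) < r.
Proof. by move=> xr yr; apply: padic_absD_lt; rewrite ?padic_absN. Qed.

Lemma padic_abs_sum_le r (I : Type) (s : seq I) (P : pred I) (F : I -> 'Q_[p]) :
  0 <= r -> (forall i, P i -> abs (F i) <= r) -> abs (\sum_(i <- s | P i) F i) <= r.
Proof.
move=> r0 Fr; apply: (big_ind (fun x => abs x <= r)) => //; first by rewrite padic_abs0.
exact: padic_absD_le.
Qed.

Lemma padic_absX x n : abs (x ^+ n) = abs x ^+ n.
Proof. by elim: n => [|n IH]; rewrite ?expr0 ?padic_abs1 // !exprS padic_absM IH. Qed.

Lemma padic_abs_prime : abs q%:R = q%:R^-1.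
Proof. by rewrite padic_absE padic_norm_p fmorphV /= ratr_nat. Qed.

Lemma prime_gt1R : 1 < q%:R :> R. Proof. by rewrite ltr1n q_gt1. Qed.

Lemma prime_gt0R : 0 < q%:R :> R. Proof. exact: lt_trans ltr01 prime_gt1R. Qed.

Lemma padic_abs_primeX n : abs (q%:R ^+ n) = q%:R ^- n.
Proof. by rewrite padic_absX padic_abs_prime exprVn. Qed.

Lemma padic_prime_neq0 : (q%:R : 'Q_[p]) != 0.
Proof. by rewrite -padic_abs_gt0 padic_abs_prime invr_gt0 prime_gt0R. Qed.

Lemma padic_abs_nat_le1 k : abs k%:R <= 1.
Proof.
elim: k => [|k IH]; first by rewrite padic_abs0.
by rewrite -addn1 natrD padic_absD_le // padic_abs1.
Qed.

Lemma padic_abs_int_le1 (b : int) : abs b%:~R <= 1.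
Proof. by case: b => k; rewrite ?NegzE ?mulrNz ?padic_absN padic_abs_nat_le1. Qed.

Lemma padic_abs_coprime k : coprime q k -> abs k%:R = 1.
Proof.
move=> qk; apply/eqP; rewrite eq_le padic_abs_nat_le1 leNgt /=; apply/negP => k1.
have [a _] := Bezoutr k (ltnW (q_gt1 p)).
rewrite gcdnC; move: qk; rewrite /coprime => /eqP -> /dvdnP[j E].
have : abs ((1 + a * k)%N%:R - (a * k)%N%:R) < 1.
  apply: padic_absB_lt.
    rewrite E natrM padic_absM padic_abs_prime.
    apply: (@le_lt_trans _ _ (1 * q%:R^-1)).
      by rewrite ler_pM2r ?invr_gt0 ?prime_gt0R ?padic_abs_nat_le1.
    by rewrite mul1r invf_lt1 ?prime_gt0R ?prime_gt1R.
  rewrite natrM padic_absM (le_lt_trans _ k1) // ler_piMl ?padic_abs_ge0 //.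
  exact: padic_abs_nat_le1.
by rewrite natrD addrK padic_abs1 ltxx.
Qed.

Lemma padic_abs_nat k : (0 < k)%N -> abs k%:R = q%:R ^- logn q k.
Proof.
move=> k0; have [m qm {1}->] := pfactor_coprime (prime_q p) k0.
by rewrite natrM natrX padic_absM padic_abs_coprime // mul1r padic_abs_primeX.
Qed.

Lemma padic_abs_int (b : int) : b != 0 -> abs b%:~R = q%:R ^- logn q `|b|%N.
Proof.
move=> b0; rewrite -padic_abs_nat ?absz_gt0 //.
by case: b b0 => k //; rewrite NegzE mulrNz padic_absN abszN.
Qed.

Lemma le_expV (m n : nat) : ((q%:R : R) ^- m <= q%:R ^- n) = (n <= m)%N.
Proof.
by rewrite lef_pV2 ?posrE ?exprn_gt0 ?prime_gt0R // ler_eXn2l // prime_gt1R.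
Qed.

Lemma padic_abs_int_le (b : int) t :
  (abs b%:~R <= q%:R ^- t) = (q ^ t %| `|b|)%N.
Proof.
have [->|b0] := eqVneq b 0.
  by rewrite padic_abs0 dvdn0 invr_ge0 exprn_ge0 // ltW // prime_gt0R.
by rewrite padic_abs_int // le_expV pfactor_dvdn ?prime_q // absz_gt0.
Qed.

Lemma padic_abs_int_lt (b : int) t :
  abs b%:~R < (q%:R : R) ^- t * q%:R -> (q ^ t %| `|b|)%N.
Proof.
have [->|b0] := eqVneq b 0; first by rewrite dvdn0.
case: t => [|t]; first by rewrite dvd1n.
rewrite exprSr invfM mulfVK; last by rewrite gt_eqF // prime_gt0R.
rewrite -padic_abs_int_le padic_abs_int // ltf_pV2 ?posrE ?exprn_gt0 ?prime_gt0R //.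
by rewrite ltr_eXn2l ?prime_gt1R // le_expV.
Qed.

Lemma padic_int_neq0 (b : int) : (b%:~R != 0 :> 'Q_[p]) = (b != 0).
Proof.
apply/idP/idP; first by apply: contraNneq => ->.
move=> b0; rewrite -padic_abs_gt0 padic_abs_int // invr_gt0.
by rewrite exprn_gt0 // prime_gt0R.
Qed.

Lemma padic_abs_frac (a b : padic_int p) : b != 0 ->
  abs (FracField.tofrac a / FracField.tofrac b) =
    ratr (padic_int_norm a) / ratr (padic_int_norm b).
Proof. by move=> b0; rewrite padic_absE padic_norm_frac // fmorph_div. Qed.

Lemma padic_abs_tofrac (a : padic_int p) :
  abs (FracField.tofrac a) = ratr (padic_int_norm a).
Proof.
have n1 : padic_int_norm (1 : padic_int p) = 1.
  by rewrite (@padic_int_normE _ _ 1%N) /= expn1 modn_small ?q_gt1 // logn1 expr0 invr1.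
rewrite -[FracField.tofrac a]divr1 -tofrac1 padic_abs_frac ?oner_eq0 //.
by rewrite n1 rmorph1 divr1.
Qed.

Lemma padic_abs_residue (a : padic_int p) n :
  abs (FracField.tofrac a - (a n)%:R) <= q%:R ^- n.
Proof.
rewrite -(rmorph_nat (@FracField.tofrac _)) -tofracB padic_abs_tofrac.
rewrite -[leRHS](_ : ratr (q%:R ^- n) = _); last first.
  by rewrite fmorphV rmorphXn /= ratr_nat.
rewrite ler_rat padic_int_norm_le; apply/eqP.
have E : (a - (a n)%:R + (a n)%:R : padic_int p) n = a n by rewrite subrK.
move: E; rewrite residueD residue_nat modnDmr => E.
have lt := residue_lt (a - (a n)%:R) n.
move/eqP: E; rewrite -[X in _ == X](residue_small a n) -[X in _ == X %[mod _]]add0n.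
by rewrite eqn_modDr modn_small // mod0n => /eqP.
Qed.

Let fracB_decomp (K : fieldType) (A B x y j t : K) : B != 0 ->
  A / B - j = (A - x * t - j * (B - y * t) + (x - j * y) * t) / B.
Proof. by move=> B0; field. Qed.

Lemma padic_int_dense z s : abs z <= 1 ->
  exists2 j, (j < q ^ s)%N & abs (z - j%:R) <= q%:R ^- s.
Proof.
rewrite (padic_fracE z); set a := (frac _).1; set b := (frac _).2.
have b0 : b != 0 by exact: denom_ratioP.
have fb0 : FracField.tofrac b != 0 by rewrite tofrac_eq0.
have [n0 bn0] := residue_neq0 b0.
set v := logn q (b n0); have bv : abs (FracField.tofrac b) = q%:R ^- v.
  by rewrite padic_abs_tofrac (padic_int_normE bn0) fmorphV rmorphXn /= ratr_nat.
have qv0 : 0 < (q%:R : R) ^- v by rewrite invr_gt0 exprn_gt0 // prime_gt0R.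
rewrite padic_absM padic_absV bv ler_pdivrMr // mul1r => av.
set N := (n0 + (v + s))%N.
have aN := padic_abs_residue a N; have bN := padic_abs_residue b N.
have vN : (v <= N)%N by rewrite /N addnCA leq_addr.
have bN0 : b N != 0%N.
  apply: contraNneq bn0 => bN0.
  by rewrite -(residue_mod b (leq_addr (v + s) n0)) -/N bN0 mod0n.
have lbN : logn q (b N) = v by rewrite (logn_residue bn0 (leq_addr _ _)).
have [b' qb' bE] : {b' | coprime q b' & b N = (b' * q ^ v)%N}.
  by rewrite -lbN; apply: pfactor_coprime; rewrite ?prime_q ?lt0n.
have [a' aE] : exists a', a N = (a' * q ^ v)%N.
  apply/dvdnP; have -> : a N = `|Posz (a N)|%N by [].
  rewrite -padic_abs_int_le.
  have -> : (Posz (a N))%:~R = FracField.tofrac a - (FracField.tofrac a - (a N)%:R).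
    by rewrite subKr.
  by apply: padic_absB_le => //; rewrite (le_trans aN) // le_expV.
have [u _] := Bezoutr b' (expq_gt0 p s).
have /eqP -> : coprime b' (q ^ s) by rewrite coprime_sym coprimeXl.
move=> uE; pose j0 : int := - (a' * u)%:Z.
pose j := `|(j0 %% (q ^ s)%:Z)%Z|%N.
have qs0 : (0 < (q ^ s)%:Z :> int) by rewrite ltz_nat expq_gt0.
have jE : (j%:Z = (j0 %% (q ^ s)%:Z)%Z).
  by rewrite /j gez0_abs // modz_ge0 // gt_eqF.
exists j; first by rewrite -ltz_nat jE ltz_pmod.
have dvdj : (q ^ s %| absz (a'%:Z - j%:Z * b'%:Z)%R)%N.
  suff : ((q ^ s)%:Z %| a'%:Z - j%:Z * b'%:Z)%Z by [].
  have -> : a'%:Z - j%:Z * b'%:Z =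
    a'%:Z * (1 + u * b')%N%:Z + (j0 %/ (q ^ s)%:Z)%Z * b'%:Z * (q ^ s)%:Z.
    rewrite jE; move: (divz_eq j0 (q ^ s)%:Z) => E.
    have -> : (j0 %% (q ^ s)%:Z)%Z = j0 - (j0 %/ (q ^ s)%:Z)%Z * (q ^ s)%:Z.
      by rewrite {2}E addrC addKr.
    by rewrite /j0 PoszD !PoszM; ring.
  by apply: rpredD; [apply: dvdz_mull | apply: dvdz_mull].
have -> : FracField.tofrac a / FracField.tofrac b - j%:R =
   (FracField.tofrac a - (a N)%:R - j%:R * (FracField.tofrac b - (b N)%:R)
     + (a'%:Z - j%:Z * b'%:Z)%:~R * q%:R ^+ v) / FracField.tofrac b.
  have -> : ((a'%:Z - j%:Z * b'%:Z)%:~R : 'Q_[p]) = a'%:R - j%:R * b'%:R.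
    by rewrite rmorphB rmorphM.
  by rewrite aE bE !natrM !natrX; exact: fracB_decomp.
rewrite padic_absM padic_absV bv.
rewrite ler_pdivrMr; last exact: qv0.
have -> : (q%:R : R) ^- s * q%:R ^- v = q%:R ^- (v + s).
  by rewrite exprD invfM mulrC.
have NE : (v + s <= N)%N by rewrite leq_addl.
apply: padic_absD_le.
  apply: padic_absB_le; first by rewrite (le_trans aN) // le_expV.
  rewrite padic_absM (le_trans (ler_piMl _ (padic_abs_nat_le1 _))) ?padic_abs_ge0 //.
  by rewrite (le_trans bN) // le_expV.
rewrite padic_absM padic_abs_primeX exprD invfM mulrC.
by rewrite ler_pM2l // padic_abs_int_le.
Qed.

End PadicAbs.

Lemma padic_abs_prod_ge (R : realType) (S : {fset primeNat}) (b : int) : b != 0 ->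
  (`|b|%N%:R : R)^-1 <= \prod_(nu : S) @padic_abs R (val nu) b%:~R.
Proof.
move=> b0; under eq_bigr => nu _ do rewrite padic_abs_int //.
rewrite prodfV lef_pV2 ?posrE ?prodr_gt0 ?ltr0n ?absz_gt0 //; last first.
  by move=> nu _; rewrite exprn_gt0 // prime_gt0R.
under eq_bigr => nu _ do rewrite -natrX.
rewrite -natr_prod ler_nat dvdn_leq ?absz_gt0 //.
have := index_enum_uniq (fset_sub_type S : finType).
elim: (index_enum _) => [|nu s IH] /=; first by rewrite big_nil dvd1n.
move=> /andP[nus us]; rewrite big_cons Gauss_dvd ?IH ?andbT ?pfactor_dvdnn //.
rewrite coprimeXl // big_seq; elim/big_ind : _ => [|i j ci cj|i si].
- exact: coprimen1.
- by rewrite coprimeMr ci.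
- rewrite coprimeXr // prime_coprime ?prime_q // dvdn_prime2 ?prime_q //.
  by apply: contraNneq nus => /val_inj/val_inj ->.
Qed.

(** * Topology of Q_S^d *)

Lemma nbhs_prod_topology (K : numFieldType) (I : finType)
    (T : I -> pseudoMetricType K) (x : prod_topology T) (A : set (prod_topology T)) :
  nbhs x A -> exists2 e : K, 0 < e &
    forall y : prod_topology T, (forall i, ball (x i) e (y i)) -> A y.
Proof.
pose E (e : K) : set (prod_topology T) := [set y | forall i, ball (x i) e (y i)].
pose F := filter_from [set e : K | 0 < e] E.
have FF : Filter F.
  apply: filter_from_filter; first by exists 1; exact: ltr01.
  move=> e1 e2 /= e10 e20; exists (Num.min e1 e2).
    by rewrite /= minElt; case: ifP.
  move=> y yE; have r12 : e1 >=< e2 by apply: real_comparable; apply: ger0_real; apply: ltW.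
  by split=> i; apply: le_ball (yE i); rewrite comparable_ge_min ?lexx ?orbT.
suff : F --> x by move=> /(_ A)/[apply] -[e e0 eA]; exists e.
apply/cvg_sup => i B; rewrite nbhsE => -[_ [[C oC <-] Cx] CB].
have /nbhs_ballP[e e0 eC] : nbhs (x i) C by apply: open_nbhs_nbhs; split.
by exists e => // y yE; apply: CB; apply: eC; exact: yE.
Qed.

Section Box.
Variables (R : realType) (S : {fset primeNat}) (d : nat).
Local Notation abs := (@padic_abs R _).
Local Notation q nu := ((val (val nu))%:R : R).

Definition box (c : QS S d) (t : 'I_d -> S -> nat) : set (QS S d) :=
  [set y | forall i nu, abs (y nu 0 i - c nu 0 i) <= q nu ^- t i nu].

Lemma boxxx c t : box c t c.
Proof.
by move=> i nu; rewrite subrr padic_abs0 invr_ge0 exprn_ge0 // ltW // prime_gt0R.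
Qed.

Lemma box_sub c c' t t' : box c' t' c -> (forall i nu, (t' i nu <= t i nu)%N) ->
  box c t `<=` box c' t'.
Proof.
move=> cc' tt' y yc i nu; rewrite -(subrKA (c nu 0 i)).
by apply: padic_absD_le => //; rewrite (le_trans (yc _ _)) // le_expV.
Qed.

Lemma box_sym c c' t : box c t c' -> box c' t c.
Proof. by move=> cc' i nu; rewrite padic_absBC. Qed.

Lemma box_eq c c' t : box c t c' -> box c' t = box c t.
Proof.
move=> cc'; apply/seteqP; split; apply: box_sub => //.
exact: box_sym.
Qed.

End Box.

Lemma expV_small (R : realType) (p : primeNat) (e : R) : 0 < e ->
  exists M, (val p)%:R ^- M < e.
Proof.
move=> e0; have q1 := @prime_gt1R R p.
have := cvg_expr (z := (val p)%:R^-1 : R).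
have qi0 : 0 <= ((val p)%:R^-1 : R) by rewrite invr_ge0 ltW // prime_gt0R.
rewrite ger0_norm // invf_lt1 ?prime_gt0R // => /(_ q1).
move=> /cvgrPdist_lt /(_ e e0) [M _ MM].
by exists M; have := MM M (leqnn M); rewrite /= sub0r normrN exprVn ger0_norm.
Qed.

Lemma ball_padicE p (x y : 'Q_[p]) e : ball x e y = (padic_norm (x - y) < e) :> Prop.
Proof. by []. Qed.

Lemma nbhs_rV_padic (R : realType) (p : primeNat) d (x : 'rV['Q_[p]]_d)
    (A : set 'rV['Q_[p]]_d) :
  nbhs x A <-> exists M, forall y : 'rV['Q_[p]]_d,
    (forall i, @padic_abs R _ (y 0 i - x 0 i) <= (val p)%:R ^- M) -> A y.
Proof.
split.
  move=> /nbhs_ballP[e e0 eA].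
  have [M Me] : exists M, (val p)%:R ^- M < (ratr e : R) by apply: expV_small; rewrite ltr0q.
  exists M => y yx; apply: eA; split=> // i j.
  rewrite ball_padicE -(ltr_rat R) ord1 -[X in X < _]padic_absE padic_absBC.
  exact: le_lt_trans (yx _) Me.
move=> [M MA]; apply/nbhs_ballP; exists ((val p)%:R ^- M).
  by rewrite /= invr_gt0 exprn_gt0 // q_gt0.
move=> y [_ yx]; apply: MA => i; have := yx 0 i.
rewrite ball_padicE -(ltr_rat R) -[X in X < _]padic_absE padic_absBC => /ltW.
by rewrite fmorphV rmorphXn /= ratr_nat.
Qed.

Section BoxTopology.
Variables (R : realType) (S : {fset primeNat}) (d : nat).
Local Notation abs := (@padic_abs R _).
Local Notation q nu := ((val (val nu))%:R : R).
Local Notation box := (@box R S d).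

Lemma nbhs_QS (x : QS S d) (A : set (QS S d)) :
  nbhs x A <-> exists M, box x (fun _ _ => M) `<=` A.
Proof.
split.
  move=> /nbhs_prod_topology [e e0 eA].
  have /choice[M Me] : forall nu : S, exists M, q nu ^- M < ratr e.
    by move=> nu; apply: expV_small; rewrite ltr0q.
  exists (\max_nu M nu)%N => y yx; apply: eA => nu; split=> // i j.
  rewrite ball_padicE -(ltr_rat R) ord1 -[X in X < _]padic_absE padic_absBC.
  apply: le_lt_trans (Me nu); apply: le_trans (yx _ _) _.
  by rewrite le_expV leq_bigmax.
move=> [M MA]; apply: filterS MA _.
have -> : box x (fun _ _ => M) = [set y : QS S d | forall nu : S,
    (proj nu @^-1` [set z : 'rV_d | forall i, abs (z 0 i - x nu 0 i) <= q nu ^- M]) y].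
  by apply/seteqP; split => [y yx nu i|y yx i nu]; [exact: yx|exact: (yx nu)].
apply: (@filter_forall _ _ _ (nbhs x)) => nu; apply: proj_continuous.
by apply/(@nbhs_rV_padic R); exists M.
Qed.

Lemma box_open c t : open (box c t).
Proof.
rewrite openE => x cx; apply/nbhs_QS.
exists (\max_i \max_nu t i nu)%N; apply: box_sub => // i nu.
by rewrite (leq_trans _ (leq_bigmax i)) // (leq_bigmax nu).
Qed.

Lemma open_QS (A : set (QS S d)) :
  open A <-> forall x, A x -> exists M, box x (fun _ _ => M) `<=` A.
Proof.
rewrite openE; split=> [oA x /oA /nbhs_QS//|oA x /oA xA].
exact/nbhs_QS.
Qed.

Lemma open_measurable_QS (A : set (borelQS S d)) : open (A : set (QS S d)) -> measurable A.
Proof. exact: sub_sigma_algebra. Qed.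

End BoxTopology.

(** * Unions of boxes under Haar measure *)

Section Haar.
Variables (R : realType) (S : {fset primeNat}) (d : nat).
Local Notation abs := (@padic_abs R _).
Local Notation q nu := ((val (val nu))%:R : R).
Local Notation box := (@box R S d).

Lemma QS_addK (x : QS S d) : cancel (QS_add x) (QS_add (fun nu => - x nu)).
Proof. by move=> y; apply: functional_extensionality_dep => nu; rewrite /QS_add addKr. Qed.

Lemma QS_addNK (x : QS S d) : cancel (QS_add (fun nu => - x nu)) (QS_add x).
Proof. by move=> y; apply: functional_extensionality_dep => nu; rewrite /QS_add addNKr. Qed.

Lemma image_QS_add (x : QS S d) (A : set (QS S d)) :
  QS_add x @` A = QS_add (fun nu => - x nu) @^-1` A.
Proof.
apply/seteqP; split=> [_ [y Ay <-]|y Ay]; first by rewrite /preimage /= QS_addK.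
by exists (QS_add (fun nu => - x nu) y); rewrite ?QS_addNK.
Qed.

Lemma box_shift (x c : QS S d) t y :
  box c t y -> box (QS_add x c) t (QS_add x y).
Proof. by move=> cy i nu; rewrite !mxE opprD addrACA subrr add0r; exact: cy. Qed.

Lemma preimage_QS_add_open (x : QS S d) (A : set (QS S d)) :
  open A -> open (QS_add x @^-1` A).
Proof.
move=> /(@open_QS R) oA; apply/(@open_QS R) => y /oA[M MA].
by exists M => z /(box_shift x) /MA.
Qed.

Lemma measurable_QS_add (x : QS S d) (A : set (borelQS S d)) :
  measurable A -> measurable (QS_add x @^-1` A : set (borelQS S d)).
Proof.
pose C := [set B : set (borelQS S d) | measurable (QS_add x @^-1` B : set (borelQS S d))].
suff : measurable `<=` C by apply.
apply: smallest_sub; last first.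
  by move=> B oB; apply: open_measurable_QS; exact: preimage_QS_add_open.
split=> [|B CB|F CF]; rewrite /C /=.
- by rewrite preimage_set0; exact: measurable0.
- by rewrite setTD; rewrite preimage_setC; exact: measurableC.
- by rewrite preimage_bigcup; apply: bigcup_measurable => k _; exact: CF.
Qed.

Variables (mu : {measure set (borelQS S d) -> \bar R}).
Hypothesis mu_inv : forall (x : QS S d) (A : set (borelQS S d)), measurable A ->
  mu (QS_add x @` A) = mu A.

Definition axis (i0 : 'I_d) (nu0 : S) (a : int) : QS S d :=
  fun nu => \row_i (if (i == i0) && (nu == nu0) then a%:~R else 0).

Lemma box_axis i0 (nu0 : S) a c t y : abs (a%:~R : 'Q_[val nu0]) <= q nu0 ^- t i0 nu0 ->
  box c t y -> box c t (QS_add (axis i0 nu0 a) y).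
Proof.
move=> ha cy i nu; rewrite !mxE -addrA; apply: padic_absD_le => //.
case: ifP => [/andP[/eqP -> /eqP ->]//|_].
by rewrite padic_abs0 invr_ge0 exprn_ge0 // ltW // prime_gt0R.
Qed.

Definition refine (i0 : 'I_d) (nu0 : S) (s : nat) (t : 'I_d -> S -> nat) :=
  fun i nu => (t i nu + (if (i == i0) && (nu == nu0) then s else 0))%N.

Definition boxes (B : set (QS S d * ('I_d -> S -> nat))) f : set (borelQS S d) :=
  \bigcup_(b in B) box b.1 (f b.2).

Lemma boxes_open B f : open (boxes B f : set (QS S d)).
Proof. by apply: bigcup_open => b _; exact: box_open. Qed.

Lemma boxes_measurable B f : measurable (boxes B f).
Proof. by apply: open_measurable_QS; exact: boxes_open. Qed.

Lemma axis_digit i0 (nu0 : S) s (c x : QS S d) t : box c t x ->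
  exists2 j : nat, (j < val (val nu0) ^ s)%N &
    box c (refine i0 nu0 s t)
      (QS_add (axis i0 nu0 (- (j * val (val nu0) ^ (t i0 nu0))%N%:Z)) x).
Proof.
set u := t i0 nu0; set p := val (val nu0) => cx.
have p0 : (p%:R : 'Q_[val nu0]) ^+ u != 0 by rewrite expf_neq0 // padic_prime_neq0.
have pu : 0 < (p%:R : R) ^- u by rewrite invr_gt0 exprn_gt0 // prime_gt0R.
have [|j js jx] := @padic_int_dense R _ ((x nu0 0 i0 - c nu0 0 i0) / p%:R ^+ u) s.
  rewrite padic_absM padic_absV padic_abs_primeX.
  rewrite ler_pdivrMr; last exact: pu.
  by rewrite mul1r; exact: cx.
exists j => // i nu; rewrite !mxE /refine.
case: ifP => [/andP[/eqP -> /eqP ->]|_]; last by rewrite add0r addn0; exact: cx.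
rewrite -/u.
have -> : (- (j * p ^ u)%N%:Z)%:~R + x nu0 0 i0 - c nu0 0 i0 =
    ((x nu0 0 i0 - c nu0 0 i0) / p%:R ^+ u - j%:R) * (p%:R : 'Q_[val nu0]) ^+ u.
  by rewrite mulrBl divfK // rmorphN /= -natrX -natrM -addrA addrC.
rewrite padic_absM padic_abs_primeX exprD invfM mulrC.
by rewrite ler_pM2l.
Qed.

(* Let [V t] be the union of the boxes of level t in the chosen coordinate.  The
   part of [V t] outside the larger boxes is invariant under translation by
   multiples of q^t in that coordinate, hence covered by q^s translates of its
   intersection with the refined boxes of level t. *)
Lemma boxes_refine_le (i0 : 'I_d) (nu0 : S) (s : nat) B f :
  (mu (boxes B f) <= ((val (val nu0)) ^ s)%:R%:E * mu (boxes B (refine i0 nu0 s \o f)))%E.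
Proof.
set Q := (val (val nu0) ^ s)%N.
pose L t : set (QS S d * ('I_d -> S -> nat)) := [set b | B b /\ f b.2 i0 nu0 = t].
pose V t := boxes (L t) f; pose V' t := boxes (L t) (refine i0 nu0 s \o f).
have VU : boxes B f = \bigcup_t V t.
  apply/seteqP; split=> [x [b Bb bx]|x [t _ [b [Bb _] bx]]]; last by exists b.
  by exists (f b.2 i0 nu0) => //; exists b.
have mW t : measurable (seqDU V t).
  apply: measurableD; first exact: boxes_measurable.
  by apply: bigsetU_measurable => k _; exact: boxes_measurable.
have mVW t : measurable (V' t `&` seqDU V t).
  by apply: measurableI => //; exact: boxes_measurable.
have step t : (mu (seqDU V t) <= Q%:R%:E * mu (V' t `&` seqDU V t))%E.
  pose T j := QS_add (axis i0 nu0 (j * val (val nu0) ^ t)%N%:Z) @` (V' t `&` seqDU V t).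
  have mT j : measurable (T j : set (borelQS S d)).
    by rewrite /T image_QS_add; exact: measurable_QS_add.
  have -> : (Q%:R%:E * mu (V' t `&` seqDU V t) = \sum_(j < Q) mu (T j))%E.
    under eq_bigr => j _ do rewrite mu_inv //.
    by rewrite sumr_const card_ord mule_natl.
  apply: content_subadditive => //.
  rewrite -bigcup_mkord => x [Vx nVx].
  have [b [Bb bt] bx] := Vx; have [j jQ jx] := axis_digit i0 nu0 s bx.
  set a := (j * _)%N%:Z in jx; pose y := QS_add (axis i0 nu0 (- a)) x.
  have axisN : QS_add (axis i0 nu0 a) y = x.
    rewrite -[RHS](QS_addNK (axis i0 nu0 a)); congr QS_add.
    apply: functional_extensionality_dep => nu; apply/rowP => i.
    rewrite /y /QS_add !mxE; congr (_ + _).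
    by case: ifP => _; rewrite ?oppr0 // rmorphN.
  have an k : (k <= t)%N -> abs (a%:~R : 'Q_[val nu0]) <= q nu0 ^- k.
    move=> kt; rewrite padic_abs_int_le /a bt absz_nat.
    by rewrite dvdn_mull // dvdn_exp2l.
  have Vax z k : (k <= t)%N -> V k z -> V k (QS_add (axis i0 nu0 a) z).
    move=> kt [b' [Bb' b't] b'z]; exists b' => //; apply: box_axis => //.
    by rewrite b't; exact: an.
  exists j => //; exists y; last by rewrite -axisN /a bt.
  split; first by exists b.
  split.
    exists b => //; apply: box_axis => //.
    by rewrite bt rmorphN padic_absN; exact: an.
  rewrite -bigcup_mkord => -[k /= kt Vky]; apply: nVx; rewrite -bigcup_mkord.
  by exists k => //; rewrite -axisN; apply: Vax => //; exact: ltnW.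
rewrite VU seqDU_bigcup_eq measure_semi_bigcup //; last first.
  by apply: bigcup_measurable.
apply: (@le_trans _ _ (\sum_(t <oo) Q%:R%:E * mu (V' t `&` seqDU V t))%E).
  exact: lee_nneseries.
rewrite nneseriesZl //.
apply: lee_wpmul2l => //.
rewrite -measure_semi_bigcup //.
- apply: le_measure; rewrite ?inE //.
  + exact: bigcup_measurable.
  + exact: boxes_measurable.
  + by move=> x [t _ [[b [Bb _] bx] _]]; exists b.
- exact/trivIset_setIl/trivIset_seqDU.
- exact: bigcup_measurable.
Qed.

Lemma refine_seqE s (l : seq ('I_d * S)) t i nu : uniq l ->
  foldr (fun k g => refine k.1 k.2 s \o g) id l t i nu =
    (t i nu + (if (i, nu) \in l then s else 0))%N.
Proof.
elim: l => [|k l IH] /=; first by rewrite addn0.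
move=> /andP[kl ul]; rewrite {1}/refine IH // in_cons -addnA; congr addn.
rewrite -xpair_eqE -surjective_pairing; have [->|_] := eqVneq; last by rewrite addn0.
by rewrite (negbTE kl).
Qed.

Lemma boxes_dilate_le s : exists2 K : R, 0 <= K & forall B,
  (mu (boxes B id) <= K%:E * mu (boxes B (fun t i nu => t i nu + s)%N))%E.
Proof.
pose l := index_enum ('I_d * S : finType)%type.
exists (\prod_(k <- l) ((val (val k.2)) ^ s)%:R); first by apply: prodr_ge0.
move=> B; have -> : (fun t i nu => t i nu + s)%N =
    foldr (fun k g => refine k.1 k.2 s \o g) id l.
  apply: funext => t; apply: funext => i; apply: funext => nu.
  by rewrite refine_seqE ?mem_index_enum // index_enum_uniq.
elim: (l) => [|k l' IH]; first by rewrite big_nil mul1e.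
rewrite big_cons (le_trans IH) // mulrC EFinM -muleA.
by apply: lee_wpmul2l; rewrite ?lee_fin ?prodr_ge0 // boxes_refine_le.
Qed.

(* Stands in for the Lebesgue density theorem: every point of [U `\` V] lies in
   small boxes a fixed proportion of which is covered by [V]. *)
Lemma null_of_boxes (U V : set (QS S d)) (N : set (borelQS S d)) s :
  open U -> open V -> (mu U < +oo)%E -> mu.-negligible N ->
  (forall x M, U x -> ~ V x -> ~ N x -> exists c t,
     [/\ box c t x, box c t `<=` box x (fun _ _ => M) &
         box c (fun i nu => t i nu + s)%N `<=` V]) ->
  mu (U `\` V) = 0%E.
Proof.
move=> oU oV Ufin [N' [mN' N'0 NN']] hx.
have mU : measurable (U : set (borelQS S d)) by exact: open_measurable_QS.
have mV : measurable (V : set (borelQS S d)) by exact: open_measurable_QS.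
pose E : set (borelQS S d) := U `\` V.
have mE : measurable E by exact: measurableD.
pose O M : set (borelQS S d) := U `&` \bigcup_(x in E) box x (fun _ _ => M).
have mO M : measurable (O M).
  apply: open_measurable_QS; apply: openI => //.
  by apply: bigcup_open => x _; exact: box_open.
have [K K0 HK] := boxes_dilate_le s.
have EK M : (mu E <= K%:E * mu (O M `\` E))%E.
  pose B := [set b | box b.1 b.2 `<=` O M /\
                     box b.1 (fun i nu => b.2 i nu + s)%N `<=` V].
  apply: (@le_trans _ _ (mu (boxes B id `|` N'))).
    apply: le_measure; rewrite ?inE //.
      by apply: measurableU => //; exact: boxes_measurable.
    move=> x [Ux nVx]; have [N'x|N'x] := pselect (N' x); [by right|left].
    have /open_QS -/(_ R) := oU => /(_ x Ux) [M1 M1U].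
    have [|c [t [cx ct cV]]] := hx x (maxn M1 M) Ux nVx.
      by move=> /NN'.
    exists (c, t) => //; split=> //=; apply: (subset_trans ct) => y xy.
    split; first by apply: M1U; apply: box_sub xy => // *; [exact: boxxx|rewrite leq_maxl].
    exists x => //; apply: box_sub xy => // *; [exact: boxxx|by rewrite leq_maxr].
  rewrite measureU0 //; last exact: boxes_measurable.
  apply: (le_trans (HK B)); apply: lee_wpmul2l; first by rewrite lee_fin.
  apply: le_measure; rewrite ?inE //; first exact: boxes_measurable.
    exact: measurableD.
  move=> x [b [bO bV] bx]; split; last by move=> [_]; apply; exact: bV.
  by apply: bO; apply: box_sub bx => [|i nu]; [exact: boxxx|rewrite leq_addr].
have cvgO : mu \o (fun M => O M `\` E) @ \oo --> mu (\bigcap_M (O M `\` E)).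
  apply: nonincreasing_cvg_mu.
  - apply: le_lt_trans Ufin; apply: le_measure; rewrite ?inE //.
      exact: measurableD.
    by move=> x [[]].
  - by move=> M; exact: measurableD.
  - by apply: bigcap_measurable => // M _; exact: measurableD.
  - move=> M1 M2 M12; apply/subsetPset; apply: setSD.
    apply: setIS => x [y Ey yx]; exists y => //.
    by apply: box_sub yx => // *; exact: boxxx.
have capO : \bigcap_M (O M `\` E) = set0.
  apply/seteqP; split=> // x xO.
  have [[Ux _] nEx] := xO 0 I; have Vx : V x by apply: contrapT => nVx; exact: nEx.
  have /open_QS -/(_ R) := oV => /(_ x Vx) [M MV].
  have [[_ [y [_ nVy] yx]] _] := xO M I.
  by apply: nVy; apply: MV; exact: box_sym.
move: cvgO; rewrite capO measure0 => cvgO.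
apply/eqP; rewrite eq_le measure_ge0 andbT.
have : (fun M => K%:E * mu (O M `\` E))%E @ \oo --> (K%:E * 0)%E.
  by apply: cvgeZl.
by rewrite mule0 => /cvge_to_ge; apply; apply: nearW.
Qed.
End Haar.

(** * Strict differentiability of C^1 maps *)

Section StrictDifferentiability.
Variables (R : realType) (p : primeNat) (d m : nat).
Local Notation abs := (@padic_abs R p).
Local Notation q := ((val p)%:R : R).
Local Notation K := 'Q_[p].
Implicit Types (u v x y : 'rV[K]_d) (f : 'rV[K]_d -> 'rV[K]_m).

Definition pball x (M : nat) : set 'rV[K]_d :=
  [set y | forall i, abs (y 0 i - x 0 i) <= q ^- M].

Definition set_coord u (k : 'I_d) (a : K) : 'rV[K]_d := \row_j (if j == k then a else u 0 j).

(* In each variable, the first node is that of [u] and all others are that of [v]. *)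
Definition edge (beta : 'I_d -> nat) u v : prod_topology (fun i => 'rV[K]_(beta i).+1) :=
  fun i => \row_j (if j == ord0 then u 0 i else v 0 i).

Lemma diff_quot_at_edge (V : lmodType K) beta u v (i : 'I_d) (g : 'rV[K]_d -> V) w :
  diff_quot_at i (edge beta u v i) g w =
  diff_quot (fun t => g (set_coord w i t)) (u 0 i) (nseq (beta i) (v 0 i)).
Proof.
rewrite /diff_quot_at mxE eqxx; congr diff_quot.
rewrite -[in RHS](size_enum_ord (beta i)).
by elim: (enum _) => //= j s ->; rewrite mxE.
Qed.

Lemma foldr_diff_quot0 (V : lmodType K) beta u v (g : 'rV[K]_d -> V) (s : seq 'I_d) w :
  (forall i, i \in s -> beta i = 0%N) ->
  foldr (fun i => diff_quot_at i (edge beta u v i)) g s w =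
  g (\row_j if j \in s then u 0 j else w 0 j).
Proof.
elim: s w => [|i s IH] w s0 /=; first by congr g; apply/rowP => j; rewrite mxE.
rewrite diff_quot_at_edge s0 ?mem_head //= IH => [|j js]; last first.
  by apply: s0; rewrite in_cons js orbT.
congr g; apply/rowP => j; rewrite !mxE in_cons.
by have [->|] := eqVneq j i; case: ifP.
Qed.

Lemma multi_diff_quot_edge (k : 'I_d) f u v :
  multi_diff_quot f (edge (fun i => i == k) u v) =
  (u 0 k - v 0 k)^-1 *: (f u - f (set_coord u k (v 0 k))).
Proof.
rewrite /multi_diff_quot; have := enum_uniq 'I_d; have := mem_enum 'I_d.
move: (enum 'I_d) => e eT; have ke : k \in e by rewrite eT.
case/splitPr: ke eT => s1 s2 eT.
rewrite cat_uniq /= negb_or => /and3P[us1 /andP[ks1 _] /andP[ks2 us2]].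
have s0 (s : seq 'I_d) : k \notin s -> forall i, i \in s -> (i == k : nat) = 0%N.
  by move=> ks i si; case: eqVneq => // ik; rewrite -ik si in ks.
rewrite foldr_cat foldr_diff_quot0; last exact: s0.
rewrite /= diff_quot_at_edge eqxx /= !foldr_diff_quot0; try exact: s0.
have uE i : i \in s1 ++ k :: s2 by rewrite eT.
congr (_ *: (f _ - f _)); apply/rowP => j; rewrite !mxE.
  have := uE j; rewrite mem_cat in_cons.
  by have [->|jk] := eqVneq j k; case: ifP => //; case: ifP; rewrite ?orbF // => ->.
have := uE j; rewrite mem_cat in_cons.
have [->|jk] := eqVneq j k; first by rewrite (negbTE ks2).
by case: ifP => //; case: ifP; rewrite ?orbF // => ->.
Qed.

Lemma partial_strict (U : set 'rV[K]_d) f x : open U -> class_C 2 U f -> U x ->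
  forall k, exists D : 'rV[K]_m, forall e : R, 0 < e -> exists M,
    forall u v, pball x M u -> pball x M v -> forall j,
      abs (f u 0 j - f (set_coord u k (v 0 k)) 0 j - (u 0 k - v 0 k) * D 0 j)
        <= e * abs (u 0 k - v 0 k).
Proof.
move=> oU fC Ux k; pose beta i : nat := (i == k :> 'I_d).
have [|g [gcont gE]] := fC beta.
  by rewrite (bigD1 k) //= /beta eqxx big1 // => i /negbTE ->.
have xU : nbhs x U by apply: open_nbhs_nbhs.
move/(nbhs_rV_padic R) : xU => [M0 M0U].
have gridE M u v : (M0 <= M)%N -> pball x M u -> pball x M v -> grid U (edge beta u v).
  move=> M0M xu xv J; apply: M0U => i; rewrite !mxE.
  by case: ifP => _; [apply: le_trans (xu i) _|apply: le_trans (xv i) _]; rewrite le_expV.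
have pballxx M : pball x M x.
  by move=> i; rewrite subrr padic_abs0 invr_ge0 exprn_ge0 // ltW // prime_gt0R.
exists (g (edge beta x x)) => e e0.
move/subspace_continuousP : gcont.
move=> /(_ (edge beta x x) (gridE _ _ _ (leqnn _) (pballxx _) (pballxx _))).
have [M1 M1e] := expV_small p e0.
move=> /(_ [set z | forall j, abs (z 0 j - g (edge beta x x) 0 j) <= q ^- M1]).
have nb : nbhs (g (edge beta x x))
    [set z | forall j, abs (z 0 j - g (edge beta x x) 0 j) <= q ^- M1].
  by apply/(nbhs_rV_padic R); exists M1.
move=> /(_ nb) /nbhs_prod_topology[r r0 gr].
have [M2 M2r] : exists M2, q ^- M2 < ratr r by apply: expV_small; rewrite ltr0q.
exists (maxn M0 M2) => u v xu xv j.
have [uv|uv] := eqVneq (u 0 k) (v 0 k).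
  have -> : set_coord u k (v 0 k) = u.
    by apply/rowP => i; rewrite mxE; case: eqVneq => // ->.
  by rewrite uv !subrr mul0r subr0 padic_abs0 mulr0.
have uv0 : u 0 k - v 0 k != 0 by rewrite subr_eq0.
have guv : g (edge beta u v) = (u 0 k - v 0 k)^-1 *: (f u - f (set_coord u k (v 0 k))).
  rewrite -multi_diff_quot_edge; apply: gE; first exact: gridE (leq_maxl _ _) xu xv.
  move=> i j1 j2; rewrite !mxE.
  have [ik|ik] := eqVneq i k; last first.
    by move=> _; apply/val_inj; move: j1 j2; rewrite /beta (negbTE ik) => j1 j2; rewrite !ord1.
  subst i; have [->|j10] := eqVneq j1 ord0; have [->|j20] := eqVneq j2 ord0 => //.
  - by move=> E; rewrite E eqxx in uv.
  - by move=> E; rewrite E eqxx in uv.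
  - move=> _; apply/val_inj => /=.
    have b1 : (beta k <= 1)%N by rewrite /beta; case: (_ == _).
    have := ltn_ord j1; have := ltn_ord j2.
    have := j10; have := j20; rewrite -!val_eqE /= -!lt0n.
    lia.
have -> : f u 0 j - f (set_coord u k (v 0 k)) 0 j - (u 0 k - v 0 k) * g (edge beta x x) 0 j =
   (u 0 k - v 0 k) * (g (edge beta u v) 0 j - g (edge beta x x) 0 j).
  by rewrite guv !mxE mulrBr mulrA divff // mul1r.
rewrite padic_absM mulrC ler_wpM2r ?padic_abs_ge0 //.
apply: le_trans (ltW M1e); apply: gr; last exact: gridE (leq_maxl _ _) xu xv.
move=> i; split=> // i' j'; rewrite !mxE.
have br w : pball x (maxn M0 M2) w -> ball (x 0 i) r (w 0 i).
  move=> xw; rewrite ball_padicE -(ltr_rat R) -[X in X < _]padic_absE padic_absBC.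
  by apply: le_lt_trans M2r; apply: le_trans (xw i) _; rewrite le_expV leq_maxr.
by case: ifP => _; apply: br.
Qed.

Lemma pballxx x M : pball x M x.
Proof. by move=> i; rewrite subrr padic_abs0 invr_ge0 exprn_ge0 // ltW // prime_gt0R. Qed.

Lemma pball_le x M N : (M <= N)%N -> pball x N `<=` pball x M.
Proof. by move=> MN y xy i; apply: le_trans (xy i) _; rewrite le_expV. Qed.

Lemma pball_eq x y M : pball x M y -> pball y M = pball x M.
Proof.
move=> xy; apply/seteqP; split=> z zy i.
  by rewrite -(subrKA (y 0 i)); apply: padic_absD_le.
by rewrite -(subrKA (x 0 i)); apply: padic_absD_le => //; rewrite padic_absBC.
Qed.

Lemma open_pball (U : set 'rV[K]_d) x : open U -> U x -> exists M, pball x M `<=` U.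
Proof. by move=> oU Ux; apply/nbhs_rV_padic; exact: open_nbhs_nbhs. Qed.

Lemma strict_diff (U : set 'rV[K]_d) f x : open U -> class_C 2 U f -> U x ->
  exists D : 'I_d -> 'rV[K]_m, forall e : R, 0 < e -> exists M,
    forall u v, pball x M u -> pball x M v ->
    forall r, 0 <= r -> (forall k, abs (u 0 k - v 0 k) <= r) -> forall j,
      abs (f u 0 j - f v 0 j - \sum_k (u 0 k - v 0 k) * D k 0 j) <= e * r.
Proof.
move=> oU fC Ux; have /choice[D DP] := partial_strict oU fC Ux.
exists D => e e0.
have /choice[M MP] : forall k, exists M, forall u v, pball x M u -> pball x M v ->
    forall j, abs (f u 0 j - f (set_coord u k (v 0 k)) 0 j - (u 0 k - v 0 k) * D k 0 j)
        <= e * abs (u 0 k - v 0 k) by move=> k; exact: DP.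
exists (\max_k M k)%N => u v xu xv r r0 uvr j.
pose w n : 'rV[K]_d := \row_i (if (i < n)%N then v 0 i else u 0 i).
have wball n : pball x (\max_k M k)%N (w n).
  by move=> i; rewrite mxE; case: ifP => _; [exact: xv|exact: xu].
have wk (k : 'I_d) : w k 0 k = u 0 k by rewrite mxE ltnn.
have wS (k : 'I_d) : w k.+1 = set_coord (w k) k (v 0 k).
  apply/rowP => i; rewrite !mxE ltnS.
  have [->|ik] := eqVneq i k; first by rewrite leqnn.
  by rewrite leq_eqVlt (negbTE (_ : i != k :> nat)).
have -> : f u 0 j - f v 0 j = \sum_(k < d) (f (w k) 0 j - f (w k.+1) 0 j).
  have -> : u = w 0%N by apply/rowP => i; rewrite mxE.
  have -> : v = w d by apply/rowP => i; rewrite mxE ltn_ord.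
  rewrite -(big_mkord xpredT (fun k => f (w k) 0 j - f (w k.+1) 0 j)).
  rewrite -[LHS]opprB -(telescope_sumr (fun k => f (w k) 0 j)) //.
  by rewrite -sumrN; apply: eq_bigr => k _; rewrite opprB.
rewrite -sumrB; apply: padic_abs_sum_le => [|k _]; first by rewrite mulr_ge0 // ltW.
have := MP k (w k) v (pball_le (leq_bigmax k) (wball k)) (pball_le (leq_bigmax k) xv) j.
rewrite -wS wk => /le_trans; apply.
by rewrite ler_pM2l.
Qed.

(* The domain of validity being a ball of level [L], this is a locally constant
   condition on [x]. *)
Definition lip_at (U : set 'rV[K]_d) f (L : nat) x :=
  pball x L `<=` U /\ forall u v, pball x L u -> pball x L v ->
    forall r, 0 <= r -> (forall k, abs (u 0 k - v 0 k) <= r) -> forall j,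
      abs (f u 0 j - f v 0 j) <= q ^+ L * r.

Lemma lip_at_ball (U : set 'rV[K]_d) f L x y : lip_at U f L x -> pball x L y -> lip_at U f L y.
Proof. by rewrite /lip_at => Lx /pball_eq ->. Qed.

Lemma expr_large (a : R) : exists M : nat, a <= q ^+ M.
Proof.
have [a0|a0] := leP a 0; first by exists 0%N; rewrite expr0 (le_trans a0).
have [M] := @expV_small R p a^-1 (eqbRL (invr_gt0 a) a0).
by rewrite ltf_pV2 ?posrE ?exprn_gt0 ?prime_gt0R // => /ltW; exists M.
Qed.

Lemma lip_at_ex (U : set 'rV[K]_d) f x : open U -> class_C 2 U f -> U x ->
  exists L, lip_at U f L x.
Proof.
move=> oU fC Ux; have [D DP] := strict_diff oU fC Ux.
have [M1 M1U] := open_pball oU Ux.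
have [M2 M2D] := DP 1 ltr01.
have [M3 M3D] : exists M, forall k j, abs (D k 0 j) <= q ^+ M.
  have [M MP] := expr_large (\sum_k \sum_j abs (D k 0 j)).
  exists M => k j; apply: le_trans MP; rewrite (bigD1 k) //= (bigD1 j) //= -addrA.
  rewrite lerDl addr_ge0 ?sumr_ge0 // => *; rewrite ?sumr_ge0 // => *; exact: padic_abs_ge0.
pose L := (maxn M1 (maxn M2 M3)); exists L; split.
  by apply: subset_trans M1U; apply: pball_le; rewrite leq_maxl.
move=> u v xu xv r r0 uvr j.
have L2 : (M2 <= L)%N by rewrite /L; lia.
have qL : q ^+ M3 <= q ^+ L.
  by apply: ler_weXn2l; [exact/ltW/prime_gt1R|rewrite /L; lia].
have /= := M2D u v (pball_le L2 xu) (pball_le L2 xv) r r0 uvr j.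
set s := \sum_k _ => h; rewrite -(subrK s (_ - _)); apply: padic_absD_le.
  apply: le_trans h _; rewrite ler_wpM2r // exprn_ege1 //; exact/ltW/prime_gt1R.
apply: padic_abs_sum_le => [|k _]; first by rewrite mulr_ge0 // exprn_ge0 // ltW // prime_gt0R.
rewrite padic_absM mulrC ler_pM ?padic_abs_ge0 //.
exact: le_trans (M3D _ _) qL.
Qed.

Lemma lip_at_diff (U : set 'rV[K]_d) f L x : open U -> class_C 2 U f -> lip_at U f L x ->
  exists2 D : 'I_d -> 'rV[K]_m, (forall k j, abs (D k 0 j) <= q ^+ L) &
  forall e : R, 0 < e -> exists M,
    forall u, pball x M u -> 
    forall r, 0 <= r -> (forall k, abs (u 0 k - x 0 k) <= r) -> forall j,
      abs (f u 0 j - f x 0 j - \sum_k (u 0 k - x 0 k) * D k 0 j) <= e * r.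
Proof.
move=> oU fC [LU Llip]; have [D DP] := strict_diff oU fC (LU _ (pballxx _ _)).
exists D; last first.
  move=> e e0; have [M MP] := DP e e0; exists M => u xu r r0 ur j.
  by apply: MP => //; exact: pballxx.
move=> k j; have [M MP] := DP 1 ltr01.
pose N := maxn M L; pose h : K := (val p)%:R ^+ N.
have qN : 0 < q ^- N by rewrite invr_gt0 exprn_gt0 // prime_gt0R.
pose u := set_coord x k (x 0 k + h).
have ux i : u 0 i - x 0 i = if i == k then h else 0.
  rewrite mxE; case: eqVneq => [->|_]; first by rewrite addrC addKr.
  by rewrite subrr.
have uN i : abs (u 0 i - x 0 i) <= q ^- N.
  by rewrite ux; case: ifP => _; rewrite ?padic_abs_primeX // padic_abs0 ltW.
have xu K' : (K' <= N)%N -> pball x K' u by move=> /pball_le; apply.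
have := MP u x (xu _ (leq_maxl _ _)) (pballxx _ _) _ (ltW qN) uN j.
have := Llip u x (xu _ (leq_maxr _ _)) (pballxx _ _) _ (ltW qN) uN j.
rewrite (bigD1 k) //= ux eqxx big1 ?addr0; last first.
  by move=> i /negbTE ik; rewrite ux ik mul0r.
set a := f u 0 j - f x 0 j => al ah.
have : abs (h * D k 0 j) <= q ^+ L * q ^- N.
  rewrite -[h * _](subKr a); apply: padic_absB_le => //.
  apply: le_trans ah _; rewrite ler_pM2r // exprn_ege1 //; exact/ltW/prime_gt1R.
by rewrite padic_absM padic_abs_primeX mulrC ler_pM2r.
Qed.

End StrictDifferentiability.

(** * Dirichlet's theorem *)

Definition nat_height N (b : 'rV[int]_N) : nat := (\max_(i < N) `|b 0%R i|)%N.

Lemma heightE (R : realType) N (b : 'rV[int]_N) : height R b = (nat_height b)%:R.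
Proof. by []. Qed.

Lemma nat_height_ge N (b : 'rV[int]_N) i : (`|b 0%R i| <= nat_height b)%N.
Proof. exact: (leq_bigmax (F := fun i => `|b 0%R i|%N)). Qed.

Lemma nat_height_le N (b : 'rV[int]_N) H :
  (forall i, (`|b 0%R i| <= H)%N) -> (nat_height b <= H)%N.
Proof. by move=> bH; apply/bigmax_leqP => i _; exact: bH. Qed.

Lemma nat_height_gt0 N (b : 'rV[int]_N) : b != 0 -> (0 < nat_height b)%N.
Proof.
apply: contraNltn => b0; apply/eqP/rowP => i; rewrite mxE; apply/eqP.
by rewrite -absz_eq0 -leqn0 (leq_trans (nat_height_ge _ _) b0).
Qed.

Lemma row_neq0 N (b : 'rV[int]_N) : b != 0 -> exists j, b 0 j != 0.
Proof.
move=> b0; apply: contrapT => nb; case/eqP: b0; apply/rowP => j; rewrite mxE.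
by apply/eqP/negPn/negP => bj; apply: nb; exists j.
Qed.

Lemma height_ge1 (R : realType) N (b : 'rV[int]_N) : b != 0 -> 1 <= height R b.
Proof. by move=> b0; rewrite heightE ler1n nat_height_gt0. Qed.

Lemma nat_height_scale N (b c : 'rV[int]_N) k : (0 < k)%N ->
  (forall j, `|b 0%R j| = `|c 0%R j| * k)%N -> nat_height b = (nat_height c * k)%N.
Proof.
move=> k0 bc; apply/eqP; rewrite eqn_leq; apply/andP; split.
  by apply: nat_height_le => j; rewrite bc leq_mul2r nat_height_ge orbT.
rewrite -leq_divRL //; apply: nat_height_le => j.
by rewrite leq_divRL // -bc nat_height_ge.
Qed.

Lemma finite_height N H : finite_set [set b : 'rV[int]_N | (nat_height b <= H)%N].
Proof.
pose g (phi : {ffun 'I_N -> 'I_(H + H).+1}) : 'rV[int]_N :=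
  \row_i ((phi i : nat)%:Z - H%:Z).
apply: (@sub_finite_set _ _ (g @` [set: {ffun 'I_N -> 'I_(H + H).+1}])); last first.
  exact: finite_image.
move=> b /= bH; exists [ffun i => inord (absz (b 0 i + H%:Z)%R)] => //.
apply/rowP => i; rewrite mxE ffunE.
have := leq_trans (nat_height_ge b i) bH => biH.
rewrite inordK; last by lia.
by lia.
Qed.

Lemma infinite_heightP N (A : set 'rV[int]_N) :
  infinite_set A <-> forall H, exists2 b, A b & (H <= nat_height b)%N.
Proof.
split=> [infA H|AH finA].
  apply: contrapT => nA; apply: infA; apply: sub_finite_set (finite_height N H) => b Ab.
  by rewrite /= leqNgt; apply/negP => Hb; apply: nA; exists b => //; exact: ltnW.
have [F AF] := finite_fsetP.1 finA.
have [b Ab] := AH (\sum_(b <- F) nat_height b).+1.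
have bF : b \in F by have := Ab; rewrite AF.
rewrite leqNgt (big_fsetD1 b) //=; lia.
Qed.

Section Pigeonhole.
Variables (R : realType) (S : {fset primeNat}) (n : nat).
Local Notation abs := (@padic_abs R _).
Local Notation q nu := ((val (val nu))%:R : R).

Lemma pigeonhole_forms (L : 'I_n -> forall nu : S, 'rV[int]_n.+1 -> 'Q_[val nu])
    (T : 'I_n -> S -> nat) (Q : nat) :
  (forall i nu, {morph L i nu : b c / b - c}) ->
  (forall i nu b, abs (L i nu b) <= 1) ->
  (\prod_(k : 'I_n * S) (val (val k.2)) ^ T k.1 k.2 < Q.+1 ^ n.+1)%N ->
  exists b, [/\ b != 0, (nat_height b <= Q)%N &
    forall i nu, abs (L i nu b) <= q nu ^- T i nu].
Proof.
move=> Lsub L1 cardQ.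
pose I := ('I_n * S : finType)%type.
have digit (k : I) b : {j : 'I_(val (val k.2) ^ T k.1 k.2) |
    abs (L k.1 k.2 b - j%:R) <= q k.2 ^- T k.1 k.2}.
  apply: cid; have [j jlt jL] := padic_int_dense (T k.1 k.2) (L1 k.1 k.2 b).
  by exists (Ordinal jlt).
pose v (phi : {ffun 'I_n.+1 -> 'I_Q.+1}) : 'rV[int]_n.+1 := \row_i (phi i : nat)%:Z.
pose D phi := [fprod k : I => sval (digit k (v phi))].
have : ~~ injectiveb D.
  apply/negP => /injectiveP /leq_card; rewrite card_ffun !card_ord card_fprod.
  under eq_bigr => k _ do rewrite card_ord.
  by rewrite leqNgt cardQ.
move=> /injectivePn[x [y xy Dxy]]; exists (v x - v y); split.
- apply: contraNneq xy => /eqP; rewrite subr_eq0 => /eqP /rowP vxy.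
  apply/eqP/ffunP => i; apply/val_inj; have := vxy i; rewrite !mxE => -[] //.
- apply: nat_height_le => i; rewrite !mxE.
  have := ltn_ord (x i); have := ltn_ord (y i).
  by move: (nat_of_ord (x i)) (nat_of_ord (y i)) => u w; lia.
- move=> i nu; rewrite Lsub.
  have E : sval (digit (i, nu) (v x)) = sval (digit (i, nu) (v y)).
    by have := congr1 (fun f : fprod _ => f (i, nu)) Dxy; rewrite !fprodE.
  have := svalP (digit (i, nu) (v x)); have := svalP (digit (i, nu) (v y)).
  rewrite E; case: (sval (digit (i, nu) (v y))) => j /= _ hy hx.
  rewrite -(subrKA j%:R); apply: padic_absD_le; first exact: hx.
  by rewrite padic_absBC; exact: hy.
Qed.
End Pigeonhole.

Section RealPowers.
Variable R : realType.
Implicit Types (x y e : R).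

Lemma powRN_small t e : 0 < t -> 0 < e ->
  exists N : nat, forall x, N%:R <= x -> x `^ (- t) <= e.
Proof.
move=> t0 e0; pose X : R := e `^ (- t^-1).
have X0 : 0 < X by exact: powR_gt0.
have [N XN] : exists N : nat, X <= N%:R.
  by exists (Num.Def.archi_bound X); rewrite ltW // archi_boundP // ltW.
exists N => x Nx; have Xx := le_trans XN Nx.
have -> : e = X `^ (- t) by rewrite -powRrM mulrNN mulVf ?powRr1 ?gt_eqF // ltW.
rewrite !powRN lef_pV2 ?posrE ?powR_gt0 //; last exact: lt_le_trans Xx.
by apply: ge0_ler_powR; rewrite ?nnegrE ?(ltW X0) ?(ltW t0) // (le_trans (ltW X0)).
Qed.

Lemma powRN_le x y t : 0 <= t -> 0 < x -> x <= y -> y `^ (- t) <= x `^ (- t).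
Proof.
move=> t0 x0 xy; have y0 := lt_le_trans x0 xy.
rewrite !powRN lef_pV2 ?posrE ?powR_gt0 //.
by apply: ge0_ler_powR; rewrite ?nnegrE ?(ltW x0) ?(ltW y0).
Qed.

Lemma powRN_mul_small (C r s t : R) : s < t -> 0 < C -> 0 < r -> exists N : nat,
  forall x : R, 1 <= x -> N%:R <= x -> C * x `^ (- t) <= r * x `^ (- s).
Proof.
move=> st C0 r0; have [||N NP] := @powRN_small (t - s) (r / C).
- by rewrite subr_gt0.
- by rewrite divr_gt0.
exists N => x x1 Nx; have x0 : 0 < x := lt_le_trans ltr01 x1.
have -> : - t = - (t - s) + - s by rewrite opprB addrC addrA addNr add0r.
rewrite powRD; last by rewrite (gt_eqF x0) implybT.
rewrite mulrA ler_wpM2r ?powR_ge0 // mulrC -ler_pdivlMr //; exact: NP.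
Qed.

Lemma prod_powR (I : Type) (s : seq I) (P : pred I) (F : I -> R) x : 0 < x ->
  \prod_(i <- s | P i) x `^ F i = x `^ (\sum_(i <- s | P i) F i).
Proof.
move=> x0; elim/big_rec2 : _ => [|i u w _ ->]; first by rewrite powRr0.
by rewrite powRD // (gt_eqF x0) implybT.
Qed.

Lemma level_ex (p : primeNat) (r : R) : 0 < r -> r <= 1 ->
  exists t, (val p)%:R ^- t <= r /\ r < (val p)%:R ^- t * (val p)%:R.
Proof.
move=> r0 r1; have q0 := @prime_gt0R R p.
have [M /ltW Mr] := expV_small p r0.
case: (ex_minnP (ex_intro (fun t => (val p)%:R ^- t <= r) M Mr)) => t tr tmin.
exists t; split=> //; case: t tr tmin => [|t] tr tmin.
  by rewrite expr0 invr1 mul1r (le_lt_trans r1) // prime_gt1R.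
rewrite ltNge; apply/negP => h; have : (val p)%:R ^- t <= r.
  by apply: le_trans h; rewrite exprSr invfM mulfVK // gt_eqF.
by move=> /tmin; rewrite ltnn.
Qed.

End RealPowers.

Section Dirichlet.
Variables (R : realType) (S : {fset primeNat}) (n : nat).
Local Notation abs := (@padic_abs R _).
Local Notation q nu := ((val (val nu))%:R : R).
Variables (tau a : 'I_n -> S -> R) (L : 'I_n -> forall nu : S, 'rV[int]_n.+1 -> 'Q_[val nu]).
Hypothesis tau_gt0 : forall i nu, 0 < tau i nu.
Hypothesis tau_sum : \sum_i \sum_nu tau i nu = n.+1%:R.
Hypothesis a_gt0 : forall i nu, 0 < a i nu.
Hypothesis a_prod : \prod_i \prod_nu (q nu / a i nu) <= 1.
Hypothesis Lsub : forall i nu, {morph L i nu : b c / b - c}.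
Hypothesis L1 : forall i nu b, abs (L i nu b) <= 1.

Lemma dirichlet_forms : exists Q0 : nat, forall Q, (Q0 <= Q)%N ->
  exists b, [/\ b != 0, (nat_height b <= Q)%N &
    forall i nu, abs (L i nu b) <= a i nu * Q%:R `^ (- tau i nu)].
Proof.
have /choice[N0 N0P] : forall k : 'I_n * S, exists N : nat,
    forall x : R, N%:R <= x -> x `^ (- tau k.1 k.2) <= (a k.1 k.2)^-1.
  by move=> k; apply: powRN_small; rewrite ?invr_gt0.
exists (maxn 1 (\max_k N0 k)) => Q; rewrite geq_max => /andP[Q1 QN].
have Q0 : 0 < (Q%:R : R) by rewrite ltr0n.
pose rho (k : 'I_n * S) := a k.1 k.2 * Q%:R `^ (- tau k.1 k.2).
have rho0 k : 0 < rho k by rewrite mulr_gt0 // powR_gt0.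
have rho1 k : rho k <= 1.
  rewrite /rho mulrC -ler_pdivlMr // mul1r; apply: N0P.
  by rewrite ler_nat (leq_trans _ QN) // leq_bigmax.
have /choice[T TP] : forall k : 'I_n * S, exists t,
    q k.2 ^- t <= rho k /\ rho k < q k.2 ^- t * q k.2.
  by move=> k; exact: level_ex.
have [|b [b0 bQ bT]] := @pigeonhole_forms R S n L (fun i nu => T (i, nu)) Q Lsub L1.
  rewrite -(ltr_nat R) natr_prod natrX.
  apply: (@le_lt_trans _ _ (Q%:R ^+ n.+1)); last first.
    by rewrite ltr_pXn2r ?nnegrE ?ltr_nat // ?ler0n.
  apply: (@le_trans _ _ (\prod_(k : 'I_n * S) (q k.2 / rho k))).
    apply: ler_prod => k _; rewrite ler0n /= natrX -surjective_pairing.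
    have [_ /ltW h] := TP k; rewrite ler_pdivlMr //.
    by move: h; rewrite mulrC ler_pdivlMr ?exprn_gt0 ?prime_gt0R // mulrC.
  have -> : \prod_(k : 'I_n * S) (q k.2 / rho k) =
      \prod_i \prod_nu (q nu / a i nu) * \prod_i \prod_nu Q%:R `^ (tau i nu).
    rewrite !pair_bigA /= -big_split /=; apply: eq_bigr => k _.
    by rewrite /rho invfM -powRN opprK mulrA.
  under [X in _ * X]eq_bigr => i _ do rewrite prod_powR //.
  rewrite prod_powR // tau_sum powR_mulrn ?ler0n //.
  by rewrite ler_piMl // exprn_ge0 // ler0n.
exists b; split=> // i nu; apply: le_trans (bT i nu) _.
by have [] := TP (i, nu).
Qed.

(* If some nonzero b annihilates all the forms, then so do its multiples;
   otherwise no finite set of b can serve for all heights. *)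
Lemma dirichlet_infinite :
  infinite_set [set b : 'rV[int]_n.+1 | b != 0 /\
     forall i nu, abs (L i nu b) <= a i nu * height R b `^ (- tau i nu)].
Proof.
set B := [set b | _].
have [[b [b0 bL]]|noexact] := pselect (exists b, b != 0 /\ forall i nu, L i nu b = 0).
  apply/infinite_heightP => H.
  have Lk k i nu : L i nu (b *+ k) = 0.
    have L0 : L i nu 0 = 0 by rewrite -[X in L _ _ X](subrr 0) Lsub subrr.
    have LN : L i nu (- b) = 0 by rewrite -sub0r Lsub L0 bL subrr.
    elim: k => [|k IH]; first by rewrite mulr0n.
    by rewrite mulrSr -[X in _ + X]opprK Lsub IH LN subrr.
  exists (b *+ H.+1).
    split; last by move=> i nu; rewrite Lk padic_abs0 mulr_ge0 ?powR_ge0 // ltW.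
    apply: contraNneq b0 => bH; apply/eqP/rowP => j; rewrite mxE.
    have := congr1 (fun x : 'rV_ _ => x 0 j) bH; rewrite mxE mulmxnE.
    by move/eqP; rewrite -mulr_natr mulf_eq0 pnatr_eq0 orbF => /eqP.
  have [j bj] := row_neq0 b0.
  apply: leq_trans (nat_height_ge _ j); rewrite mulmxnE -mulr_natr abszM.
  have : (0 < `|b 0%R j|)%N by rewrite absz_gt0.
  by rewrite natz absz_nat; nia.
have [Q0 Q0P] := dirichlet_forms.
apply: contrapT => /contrapT finB; have [F BF] := finite_fsetP.1 finB.
have /choice[g gP] : forall b : 'rV[int]_n.+1, exists N : nat, b != 0 -> exists i nu,
    forall Q, (N <= Q)%N -> a i nu * Q%:R `^ (- tau i nu) < abs (L i nu b).
  move=> b; have [->|b0] := eqVneq b 0; first by exists 0%N.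
  have [i [nu Lb]] : exists i nu, L i nu b != 0.
    apply: contrapT => nL; apply: noexact; exists b; split=> // i nu.
    by apply/eqP/negPn/negP => Lb; apply: nL; exists i, nu.
  have Lb0 : 0 < abs (L i nu b) by rewrite padic_abs_gt0.
  have [|N NP] := @powRN_small R (tau i nu) (abs (L i nu b) / a i nu / 2%:R) (tau_gt0 i nu).
    by rewrite divr_gt0 ?ltr0n // divr_gt0.
  exists N => _; exists i, nu => Q NQ.
  apply: (@le_lt_trans _ _ (abs (L i nu b) / 2%:R)); last by rewrite gtr_pMr ?invf_lt1 ?ltr1n.
  rewrite mulrC -ler_pdivlMr // mulrAC; apply: NP.
  by rewrite ler_nat.
have [b [b0 bQ bL]] := Q0P (maxn Q0 (\sum_(b <- F) g b)) (leq_maxl _ _).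
set Q := maxn _ _ in bQ bL.
have Bb : B b.
  split=> // i nu; apply: le_trans (bL i nu) _; rewrite ler_pM2l //.
  apply: powRN_le; [exact: ltW|by rewrite ltr0n nat_height_gt0|by rewrite ler_nat].
have bF : b \in F by have := Bb; rewrite BF.
have [i [nu lt]] := gP b b0.
have gQ : (g b <= Q)%N.
  by rewrite /Q (big_fsetD1 b) //=; lia.
by have := lt_le_trans (lt Q gQ) (bL i nu); rewrite ltxx.
Qed.

End Dirichlet.

(** * Denominators of the approximations *)

Section Point.
Variables (R : realType) (S : {fset primeNat}) (n : nat).
Local Notation abs := (@padic_abs R _).
Local Notation q nu := ((val (val nu))%:R : R).
Variables (tau : 'I_n -> S -> R) (y : QS S n) (A : R).
Hypothesis tau_gt0 : forall i nu, 0 < tau i nu.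
Hypothesis A_gt0 : 0 < A.

Definition approximant (b : 'rV[int]_n.+1) : Prop := b != 0 /\
  forall i nu, abs ((b 0 ord0)%:~R * y nu 0 i - (b 0 (lift ord0 i))%:~R)
    <= A * height R b `^ (- tau i nu).

Lemma approximant_b0 : (forall i, 1 < \sum_nu tau i nu) -> exists H0 : nat,
  forall b, approximant b -> (H0 <= nat_height b)%N -> b 0 ord0 != 0.
Proof.
move=> hc.
have /choice[N NP] : forall i, exists N : nat, forall x : R, 1 <= x -> N%:R <= x ->
    (\prod_(nu : S) A) * x `^ (- \sum_nu tau i nu) <= 2%:R^-1 * x `^ (- 1).
  move=> i; apply: powRN_mul_small; rewrite ?invr_gt0 // prodr_gt0 //.
exists (\max_i N i)%N => b [b0 bA] bN; apply/negP => /eqP b00.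
have [j bj] := row_neq0 b0.
case: (unliftP ord0 j) bj => [i ->|->] bi; last by rewrite b00 eqxx in bi.
have H1 := height_ge1 R b0.
have H0 : 0 < height R b := lt_le_trans ltr01 H1.
have := padic_abs_prod_ge R S bi; apply/negP; rewrite -ltNge.
apply: (@le_lt_trans _ _ (2%:R^-1 * height R b `^ (- 1))); last first.
  apply: (@lt_le_trans _ _ (height R b)^-1).
    by rewrite powR_inv1 ?ltW // gtr_pMl ?invr_gt0 // invf_lt1 ?ltr1n.
  have bi0 : 0 < (`|b 0%R (lift ord0 i)|%N%:R : R) by rewrite ltr0n absz_gt0.
  by rewrite (lef_pV2 H0 bi0) heightE ler_nat nat_height_ge.
have HN : (N i)%:R <= height R b.
  by rewrite heightE ler_nat (leq_trans _ bN) // leq_bigmax.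
apply: le_trans (NP i _ H1 HN).
rewrite -sumrN -prod_powR // -big_split /=.
apply: ler_prod => nu _; rewrite padic_abs_ge0 /=.
by have := bA i nu; rewrite b00 mul0r sub0r padic_absN.
Qed.

Lemma padic_abs_ge_height (nu : S) (b : 'rV[int]_n.+1) : b 0 ord0 != 0 ->
  height R b `^ (- 1) <= abs ((b 0 ord0)%:~R : 'Q_[val nu]).
Proof.
move=> b00; rewrite powR_inv1; last by rewrite heightE ler0n.
apply: (@le_trans _ _ (`|b 0%R ord0|%N%:R)^-1).
  have bi0 : 0 < (`|b 0%R ord0|%N%:R : R) by rewrite ltr0n absz_gt0.
  have bH : (`|b 0%R ord0|%N%:R : R) <= height R b by rewrite heightE ler_nat nat_height_ge.
  by rewrite (lef_pV2 (lt_le_trans bi0 bH) bi0).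
rewrite padic_abs_int // lef_pV2 ?posrE ?exprn_gt0 ?prime_gt0R ?ltr0n ?absz_gt0 //.
by rewrite -natrX ler_nat dvdn_leq ?absz_gt0 // pfactor_dvdnn.
Qed.

Lemma ratio_gt1 (nu : S) (r : R) : (forall i, 1 < tau i nu) -> 0 < r ->
  exists H0 : nat, forall b, approximant b -> b 0 ord0 != 0 ->
    (H0 <= nat_height b)%N -> forall i,
    A * height R b `^ (- tau i nu) <= r * abs ((b 0 ord0)%:~R : 'Q_[val nu]).
Proof.
move=> tau1 r0.
have /choice[N NP] : forall i, exists N : nat, forall x : R, 1 <= x -> N%:R <= x ->
    A * x `^ (- tau i nu) <= r * x `^ (- 1).
  by move=> i; apply: powRN_mul_small.
exists (\max_i N i)%N => b [b0 bA] b00 bN i.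
have HN : (N i)%:R <= height R b.
  by rewrite heightE ler_nat (leq_trans _ bN) // leq_bigmax.
apply: le_trans (NP i _ (height_ge1 R b0) HN) _.
by rewrite ler_pM2l // padic_abs_ge_height.
Qed.

Variables (nu : S) (alpha w : R).
Hypothesis y_int : ZS y.
Hypothesis alpha_gt0 : 0 < alpha.
Hypothesis alpha_tau : forall i nu, alpha < tau i nu.
Hypothesis alpha_lt1 : alpha < 1.
Hypothesis exponent_lt : (exponent (shifted_weight tau nu alpha) y <= w%:E)%E.
Hypothesis w_lt : w < 1 + alpha / ((1 - alpha) * n.+1%:R).

Local Notation kappa := (shifted_weight tau nu alpha).
Let omega := 1 + alpha / ((1 - alpha) * n.+1%:R).

Let alpha1 : 0 < 1 - alpha. Proof. by rewrite subr_gt0. Qed.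
Let den_gt0 : 0 < n.+1%:R - n%:R * alpha.
Proof.
rewrite subr_gt0 -natr1 ltr_pwDr //.
by rewrite ler_piMr ?ler0n // ltW.
Qed.

Let omegaE : omega = (n.+1%:R - n%:R * alpha) / ((1 - alpha) * n.+1%:R).
Proof.
rewrite /omega -natr1; field.
by rewrite gt_eqF ?(gt_eqF alpha1) // natr1 ltr0n.
Qed.

Lemma kappa_omega i sigma : kappa i sigma * omega =
  (if sigma == nu then tau i nu - alpha else tau i sigma) / (1 - alpha).
Proof.
have d0 := gt_eqF den_gt0; have a0 := gt_eqF alpha1.
rewrite omegaE /shifted_weight -natr1 in d0 *.
by case: ifP => _; field; rewrite natr1 pnatr_eq0 -natr1 d0 a0.
Qed.

Lemma kappa_gt0 i sigma : 0 < kappa i sigma.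
Proof.
rewrite /shifted_weight; case: ifP => _; apply: divr_gt0 => //.
  by apply: mulr_gt0; rewrite ?subr_gt0 ?ltr0n.
by apply: mulr_gt0; rewrite ?ltr0n.
Qed.

Lemma exponent_gap : exists2 w' : R, w' < omega & exists H1 : nat,
  forall b : 'rV[int]_n.+1,
    (forall i sigma, abs ((b 0 ord0)%:~R * y sigma 0 i + (b 0 (lift ord0 i))%:~R)
      `^ (kappa i sigma)^-1 <= height R b `^ (- w')) -> (nat_height b < H1)%N.
Proof.
have [w' ww' w'o] : exists2 w', w < w' & w' < omega.
  by exists ((w + omega) / 2%:R); have := w_lt; rewrite -/omega; lra.
exists w' => //; apply: contrapT => nH; move: ww'; rewrite -lte_fin ltNge => /negP; apply.
apply: le_trans exponent_lt; apply: ereal_sup_ubound; exists w' => //.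
apply/infinite_heightP => H; apply: contrapT => nb; apply: nH; exists H => b bw.
rewrite ltnNge; apply/negP => Hb; apply: nb; exists b => //=.
apply: bigmax_le => [|i _]; first exact: powR_ge0.
by apply: bigmax_le => [|sigma _]; [exact: powR_ge0|exact: bw].
Qed.

Lemma powRN_root (x X s : R) : 0 < s -> 0 < X -> 0 < x -> X <= x `^ (1 - alpha) ->
  x `^ (- s) <= X `^ (- (s / (1 - alpha))).
Proof.
move=> s0 X0 x0 Xx.
have -> : x `^ (- s) = (x `^ (1 - alpha)) `^ (- (s / (1 - alpha))).
  by rewrite -powRrM mulrN mulrCA divff ?mulr1 // gt_eqF.
by apply: powRN_le => //; rewrite divr_ge0 // ltW.
Qed.

(* If [b 0 ord0] were divisible by a power of [nu] exceeding [height b `^ alpha],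
   then so would be all of [b], and dividing it out would contradict the bound
   on the exponent. *)
Lemma approximant_b0_large : exists H0 : nat, forall b, approximant b ->
  (H0 <= nat_height b)%N ->
  height R b `^ (- alpha) <= abs ((b 0 ord0)%:~R : 'Q_[val nu]).
Proof.
have [w' w'o [H1 H1P]] := exponent_gap.
have q0 : 0 < q nu := prime_gt0R R (val nu).
have /choice[N2 N2P] : forall i, exists N : nat, forall x : R, 1 <= x -> N%:R <= x ->
    A * x `^ (- tau i nu) <= 1 * x `^ (- alpha).
  by move=> i; apply: powRN_mul_small.
have /choice[N3 N3P] : forall k : 'I_n * S, exists N : nat,
    forall x : R, 1 <= x -> N%:R <= x ->
    (q nu * A) * x `^ (- (kappa k.1 k.2 * omega)) <= 1 * x `^ (- (kappa k.1 k.2 * w')).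
  by move=> k; apply: powRN_mul_small; rewrite ?mulr_gt0 // ltr_pM2l ?kappa_gt0.
pose X0 := maxn 1 (maxn H1 (\max_k N3 k)).
have [|N4 N4P] := @powRN_small R (1 - alpha) ((q nu * X0%:R)^-1) alpha1.
  by rewrite invr_gt0 mulr_gt0 // ltr0n /X0 leq_max.
exists (maxn (\max_i N2 i) N4) => b [b0 bA]; rewrite geq_max => /andP[bN2 bN4].
set x := height R b; have x1 : 1 <= x := height_ge1 R b0.
have x0 : 0 < x := lt_le_trans ltr01 x1.
rewrite leNgt; apply/negP => b0small.
have xa0 : 0 < x `^ (- alpha) by rewrite powR_gt0.
have xa1 : x `^ (- alpha) <= 1.
  by rewrite powRN invf_le1 ?powR_gt0 // -(powRr0 x) ler_powR // ltW.
have [t [tx xt]] := level_ex (val nu) xa0 xa1.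
have qt0 : 0 < q nu ^+ t by rewrite exprn_gt0.
have bdvd j : (val (val nu) ^ t %| `|b 0%R j|)%N.
  apply: padic_abs_int_lt; apply: le_lt_trans xt.
  case: (unliftP ord0 j) => [i ->|->]; last exact: ltW.
  rewrite -[X in abs X](subKr ((b 0 ord0)%:~R * y nu 0 i)); apply: padic_absB_le.
    rewrite padic_absM (le_trans _ (ltW b0small)) // ler_piMr ?padic_abs_ge0 //.
    by rewrite padic_abs_le1 y_int.
  apply: le_trans (bA _ _) _; rewrite -[leRHS]mul1r; apply: N2P => //.
  by rewrite /x heightE ler_nat (leq_trans _ bN2) // leq_bigmax.
pose c : 'rV[int]_n.+1 := \row_j (b 0%R j %/ (val (val nu) ^ t)%:Z)%Z.
have bc j : b 0 j = c 0 j * (val (val nu) ^ t)%:Z by rewrite mxE divzK //; exact: bdvd.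
pose b' : 'rV[int]_n.+1 := \row_j (if j == ord0 then c 0 j else - c 0 j).
have Hb : nat_height b = (nat_height b' * val (val nu) ^ t)%N.
  apply: nat_height_scale => [|j]; first exact: expq_gt0.
  rewrite bc abszM absz_nat [b' 0%R j]mxE; case: ifP => _ //.
  by rewrite abszN.
set X := height R b'; have xX : x = X * q nu ^+ t.
  by rewrite /x /X !heightE Hb natrM natrX.
have XE : X = x * q nu ^- t by rewrite xX mulfK // gt_eqF.
have Xup : X <= x `^ (1 - alpha).
  rewrite XE powRD; last by rewrite (gt_eqF x0) implybT.
  by rewrite powRr1 ?(ltW x0) // ler_pM2l.
have Xlow : X0%:R <= X.
  have HN4 : N4%:R <= x by rewrite /x heightE ler_nat.
  have := N4P x HN4.
  rewrite powRN lef_pV2 ?posrE ?powR_gt0 ?mulr_gt0 //; last first.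
    by rewrite ltr0n /X0 leq_max.
  move=> h; have : q nu * X0%:R <= X * q nu.
    apply: le_trans h _; rewrite powRD; last by rewrite (gt_eqF x0) implybT.
    by rewrite powRr1 ?(ltW x0) // XE -mulrA ler_pM2l // ltW.
  by rewrite mulrC ler_pM2r.
have X01 : (1 <= X0)%N by rewrite /X0 leq_max.
have X1 : 1 <= X by apply: le_trans Xlow; rewrite ler1n.
have Xgt0 : 0 < X := lt_le_trans ltr01 X1.
suff : (nat_height b' < H1)%N.
  have Xb : (X0 <= nat_height b')%N by rewrite -(ler_nat R) -heightE.
  by rewrite ltnNge (leq_trans _ Xb) // /X0 !leq_max leqnn orbT.
apply: H1P => i sigma; rewrite -/X.
have cE : (b' 0 ord0)%:~R * y sigma 0 i + (b' 0 (lift ord0 i))%:~R =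
   ((b 0 ord0)%:~R * y sigma 0 i - (b 0 (lift ord0 i))%:~R) /
     ((val (val nu))%:R : 'Q_[val sigma]) ^+ t.
  have qt : ((val (val nu))%:R : 'Q_[val sigma]) ^+ t != 0.
    rewrite -natrX -[_%:R]/((val (val nu) ^ t)%:Z%:~R) padic_int_neq0 //.
    by rewrite -absz_gt0 absz_nat expq_gt0.
  apply: (canRL (mulfK qt)); rewrite !bc !rmorphM /=.
  rewrite -[X in _ = X * _ * _ - _]/(_) -natrX.
  rewrite [b' 0 ord0]mxE [b' 0 (lift _ _)]mxE eqxx /= rmorphN /=.
  by rewrite mulrBl mulrAC.
have absc : abs ((b' 0 ord0)%:~R * y sigma 0 i + (b' 0 (lift ord0 i))%:~R)
    <= (q nu * A) * X `^ (- (kappa i sigma * omega)).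
  rewrite cE padic_absM padic_absV kappa_omega; case: eqVneq => [->|sn].
    rewrite padic_abs_primeX invrK.
    apply: (@le_trans _ _ (A * x `^ (- tau i nu) * q nu ^+ t)).
      by rewrite ler_pM2r.
    apply: (@le_trans _ _ ((q nu * A) * x `^ (- (tau i nu - alpha)))).
      have -> : - (tau i nu - alpha) = alpha - tau i nu by rewrite opprB.
      rewrite powRD; last by rewrite (gt_eqF x0) implybT.
      rewrite [leRHS](_ : _ = A * x `^ (- tau i nu) * (q nu * x `^ alpha)); last by ring.
      rewrite ler_pM2l ?mulr_gt0 ?powR_gt0 //.
      move: xt; rewrite powRN => /ltW.
      rewrite -(ler_pM2l qt0 (_^-1)) mulVKf ?gt_eqF //.
      by rewrite ler_pdivrMr ?powR_gt0.
    rewrite ler_pM2l ?mulr_gt0 //; apply: powRN_root => //.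
    by rewrite subr_gt0.
  rewrite padic_absX padic_abs_coprime; last first.
    rewrite prime_coprime ?prime_q // dvdn_prime2 ?prime_q //.
  rewrite expr1n invr1 mulr1; apply: le_trans (bA _ _) _.
  rewrite -/x; apply: (@le_trans _ _ (A * X `^ (- (tau i sigma / (1 - alpha))))).
    by rewrite ler_pM2l //; apply: powRN_root.
  rewrite ler_wpM2r ?powR_ge0 // ler_peMl ?ltW //; exact: prime_gt1R.
have : abs ((b' 0 ord0)%:~R * y sigma 0 i + (b' 0 (lift ord0 i))%:~R)
    <= X `^ (- (kappa i sigma * w')).
  apply: le_trans absc _; rewrite -[leRHS]mul1r; apply: (N3P (i, sigma)) => //.
  apply: le_trans Xlow; rewrite ler_nat /X0 !leq_max.
  by rewrite (leq_bigmax (F := N3) (i, sigma)) !orbT.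
have k0 := kappa_gt0 i sigma.
move=> /(@ge0_ler_powR R (kappa i sigma)^-1 _ _ _); rewrite ?nnegrE => h.
apply: le_trans (h _ _ _) _; rewrite ?padic_abs_ge0 ?powR_ge0 ?invr_ge0 ?(ltW k0) //.
by rewrite -powRrM mulNr mulrAC divff ?mul1r // gt_eqF.
Qed.

Lemma ratio_exponent (r : R) : 0 < r ->
  exists H0 : nat, forall b, approximant b -> (H0 <= nat_height b)%N -> forall i,
    A * height R b `^ (- tau i nu) <= r * abs ((b 0 ord0)%:~R : 'Q_[val nu]).
Proof.
move=> r0; have [H1 H1P] := approximant_b0_large.
have /choice[N NP] : forall i, exists N : nat, forall x : R, 1 <= x -> N%:R <= x ->
    A * x `^ (- tau i nu) <= r * x `^ (- alpha).
  by move=> i; apply: powRN_mul_small.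
exists (maxn H1 (\max_i N i)) => b bA; rewrite geq_max => /andP[bH bN] i.
have HN : (N i)%:R <= height R b.
  by rewrite heightE ler_nat (leq_trans _ bN) // leq_bigmax.
apply: le_trans (NP i _ (height_ge1 R bA.1) HN) _.
by rewrite ler_pM2l // H1P.
Qed.

End Point.

(** * Approximation on the manifold *)

Lemma le_prod_ge1 (R : realType) (I : finType) (F : I -> R) i :
  (forall j, 1 <= F j) -> F i <= \prod_j F j.
Proof.
move=> F1; rewrite (bigD1 i) //= ler_peMr //; first exact: le_trans (F1 i).
by apply: (big_ind (fun z => 1 <= z)) => //; exact: mulr_ege1.
Qed.

Lemma prod_ge1 (R : realType) (I : finType) (F : I -> R) :
  (forall j, 1 <= F j) -> 1 <= \prod_j F j.
Proof. by move=> F1; apply: (big_ind (fun z => 1 <= z)) => //; exact: mulr_ege1. Qed.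

Lemma subr3ACA (K : comNzRingType) (u v w z s t : K) :
  u - v - (w - z) - (s - t) = (u - w - s) - (v - z - t).
Proof. by ring. Qed.

Section Key.
Variables (R : realType) (S : {fset primeNat}) (hS : S != fset0).
Variables (d m : nat) (hd : (1 <= d)%N).
Local Notation abs := (@padic_abs R _).
Local Notation q nu := ((val (val nu))%:R : R).
Variables (U : forall nu : S, set 'rV['Q_[val nu]]_d)
  (f : forall nu : S, 'rV['Q_[val nu]]_d -> 'rV['Q_[val nu]]_m).
Arguments U : clear implicits.
Arguments f : clear implicits.
Variables (hUopen : forall nu, open (U nu))
  (hUint : forall nu x, U nu x -> forall i, padic_norm (x 0 i) <= 1)
  (hfint : forall nu x, U nu x -> forall j, padic_norm (f nu x 0 j) <= 1)
  (hfC2 : forall nu, class_C 2 (U nu) (f nu))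
  (tau : 'I_(d + m) -> S -> R)
  (htau : forall i nu, 0 < tau i nu)
  (ha : \sum_i \sum_nu tau i nu = (d + m).+1%:R)
  (hb : forall nu (i : 'I_d) (j : 'I_m),
      tau (rshift d j) nu <= tau (lshift m i) nu)
  (hc : forall i, 1 < \sum_nu tau i nu)
  (alpha : R) (alpha_gt0 : 0 < alpha)
  (alpha_tau : forall i nu, alpha < tau i nu) (alpha_lt1 : alpha < 1).
Variables (L : nat) (c : R) (c_gt0 : 0 < c).

Definition lip_set : set (QS S d) :=
  [set x | forall nu, lip_at R (U nu) (f nu) L (x nu)].

Definition good (b : 'rV[int]_(d + m).+1) : set (QS S d) :=
  [set x | domain_prod U x /\ forall i nu,
    abs ((b 0 ord0)%:~R * graph_map f x nu 0 i - (b 0 (lift ord0 i))%:~R)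
      < c * height R b `^ (- tau i nu)].

Definition good_from (N : nat) : set (QS S d) :=
  \bigcup_(b in [set b | (N <= nat_height b)%N]) good b.

Definition bounded_exponent (x : QS S d) : Prop :=
  forall nu : S, (exists i, tau i nu <= 1) -> exists2 w : R,
    w < 1 + alpha / ((1 - alpha) * (d + m).+1%:R) &
    (exponent (shifted_weight tau nu alpha) (graph_map f x) <= w%:E)%E.

Let q_ge1 (nu : S) : 1 <= q nu. Proof. exact/ltW/prime_gt1R. Qed.
Let q_gt0 (nu : S) : 0 < q nu. Proof. exact: prime_gt0R. Qed.

Let eps0 := Num.min (c / 2%:R) 1.
Let eps0_gt0 : 0 < eps0. Proof. by rewrite lt_min ltr01 divr_gt0. Qed.
Let eps0_lt : eps0 < c.
Proof. by rewrite /eps0 gt_min ltr_pdivrMr // ltr_pMr // ltr1n. Qed.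
Let eps0_le1 : eps0 <= 1. Proof. by rewrite ge_min lexx orbT. Qed.

(* [A] is chosen to make the product of the bounds [a] large enough in [a_prod]. *)
Let P := \prod_(j < m) \prod_(nu : S) (q nu * q nu ^+ L / eps0).
Let A := (\prod_(nu : S) q nu) * P.

Let P_ge1 : 1 <= P.
Proof.
do 2![apply: prod_ge1 => ?]; rewrite ler_pdivlMr // mul1r.
apply: le_trans eps0_le1 _; apply: mulr_ege1 => //; exact: exprn_ege1.
Qed.

Let A_ge1 : 1 <= A. Proof. by apply: mulr_ege1 => //; exact: prod_ge1. Qed.
Let A_gt0 : 0 < A. Proof. exact: lt_le_trans ltr01 A_ge1. Qed.

Let a (i : 'I_(d + m)) (nu : S) := if fintype.split i is inl _ then A else q nu ^- L * eps0.

Let a_gt0 i nu : 0 < a i nu.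
Proof.
by rewrite /a; case: (fintype.split i) => // _; rewrite mulr_gt0 // invr_gt0 exprn_gt0.
Qed.

Let splitl k : fintype.split (lshift m k : 'I_(d + m)) = inl k.
Proof. exact: (unsplitK (inl k)). Qed.
Let splitr k : fintype.split (rshift d k : 'I_(d + m)) = inr k.
Proof. exact: (unsplitK (inr k)). Qed.

Let a_prod : \prod_i \prod_nu (q nu / a i nu) <= 1.
Proof.
have P0 : 0 < P := lt_le_trans ltr01 P_ge1.
rewrite big_split_ord /=.
have -> : \prod_(j < m) \prod_nu (q nu / a (rshift d j) nu) = P.
  apply: eq_bigr => j _; apply: eq_bigr => nu _.
  by rewrite /a splitr invfM invrK mulrA.
rewrite -ler_pdivlMr // mul1r.
have E (i : 'I_d) : \prod_nu (q nu / a (lshift m i) nu) <= P^-1.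
  rewrite /a; under eq_bigr => nu _ do rewrite splitl.
  rewrite big_split /= prodr_const -/(_ ^+ _) exprVn.
  have S0 : (0 < #|(fset_sub_type S : finType)|)%N.
    by rewrite -cardfE cardfs_gt0.
  rewrite ler_pdivrMr ?exprn_gt0 //.
  apply: (@le_trans _ _ (P^-1 * A)); first by rewrite /A mulrCA mulVf ?mulr1 // gt_eqF.
  rewrite ler_pM2l ?invr_gt0 //.
  by rewrite -[leLHS]expr1 ler_weXn2l.
apply: (@le_trans _ _ (\prod_(i < d) P^-1)).
  apply: ler_prod => i _; rewrite E andbT; apply: prodr_ge0 => nu _.
  by apply/ltW/divr_gt0; [exact: q_gt0|exact: a_gt0].
rewrite prodr_const card_ord -[leRHS]expr1 ler_wiXn2l ?invr_ge0 ?(ltW P0) //.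
by rewrite invf_le1.
Qed.

Section AtPoint.
Variables (x : QS S d) (Lx : lip_set x) (D : forall nu : S, 'I_d -> 'rV['Q_[val nu]]_m).
Hypothesis D_le : forall nu k j, abs (D nu k 0 j) <= q nu ^+ L.

Let Ux nu : U nu (x nu). Proof. by have [LU _] := Lx nu; apply: LU; exact: pballxx. Qed.

Let x_int nu k : abs (x nu 0 k) <= 1.
Proof. by rewrite padic_abs_le1 hUint. Qed.
Let f_int nu j : abs (f nu (x nu) 0 j) <= 1.
Proof. by rewrite padic_abs_le1 hfint. Qed.

Let err (nu : S) (b : 'rV[int]_(d + m).+1) (k : 'I_d) : 'Q_[val nu] :=
  (b 0 ord0)%:~R * x nu 0 k - (b 0 (lift ord0 (lshift m k)))%:~R.

Let err_tan (nu : S) (b : 'rV[int]_(d + m).+1) (j : 'I_m) : 'Q_[val nu] :=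
  (b 0 ord0)%:~R * f nu (x nu) 0 j - (b 0 (lift ord0 (rshift d j)))%:~R
   - \sum_k err nu b k * D nu k 0 j.

Lemma tangent_dirichlet : infinite_set [set b : 'rV[int]_(d + m).+1 | [/\ b != 0,
  forall nu k, abs (err nu b k) <= A * height R b `^ (- tau (lshift m k) nu) &
  forall nu j, abs (err_tan nu b j) <= eps0 * height R b `^ (- tau (rshift d j) nu)]].
Proof.
pose F (i : 'I_(d + m)) (nu : S) b : 'Q_[val nu] := match fintype.split i with
  | inl k => err nu b k | inr j => (val (val nu))%:R ^+ L * err_tan nu b j end.
have errB nu k : {morph err nu ^~ k : b b' / b - b'}.
  move=> b b'; rewrite /err !mxE !rmorphB /= mulrBl !opprB.
  by rewrite [LHS]addrACA [RHS]addrACA (addrC (- (_ * _))) .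
have tanB nu j : {morph err_tan nu ^~ j : b b' / b - b'}.
  move=> b b'; rewrite /err_tan.
  under eq_bigr => k _ do rewrite errB mulrBl.
  by rewrite sumrB !mxE !rmorphB /= mulrBl; exact: subr3ACA.
have FB i nu : {morph F i nu : b b' / b - b'}.
  move=> b b'; rewrite /F; case: (fintype.split i) => k; first exact: errB.
  by rewrite tanB mulrBr.
have err1 nu b k : abs (err nu b k) <= 1.
  apply: padic_absB_le; last exact: padic_abs_int_le1.
  by rewrite padic_absM mulr_ile1 ?padic_abs_ge0 ?padic_abs_int_le1.
have qL1 (nu : S) : 1 <= q nu ^+ L by rewrite exprn_ege1 ?q_ge1.
have tan1 nu b j : abs (err_tan nu b j) <= q nu ^+ L.
  apply: padic_absB_le.
    apply: le_trans (qL1 nu); apply: padic_absB_le; last exact: padic_abs_int_le1.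
    by rewrite padic_absM mulr_ile1 ?padic_abs_ge0 ?padic_abs_int_le1.
  apply: padic_abs_sum_le => [|k _]; first exact: le_trans ler01 (qL1 nu).
  by rewrite padic_absM -[leRHS]mul1r ler_pM ?padic_abs_ge0.
have F1 i nu b : abs (F i nu b) <= 1.
  rewrite /F; case: (fintype.split i) => k; first exact: err1.
  by rewrite padic_absM padic_abs_primeX ler_pdivrMl ?exprn_gt0 // mulr1.
apply: sub_infinite_set (dirichlet_infinite htau ha a_gt0 a_prod FB F1) => b [b0 bF].
split=> // nu k.
  by have := bF (lshift m k) nu; rewrite /F /a splitl.
have := bF (rshift d k) nu; rewrite /F /a splitr padic_absM padic_abs_primeX.
by rewrite -mulrA ler_pM2l // invr_gt0 exprn_gt0.
Qed.

Hypothesis D_diff : forall nu (e : R), 0 < e -> exists M,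
  forall u, pball R (x nu) M u ->
  forall r, 0 <= r -> (forall k, abs (u 0 k - x nu 0 k) <= r) -> forall j,
    abs (f nu u 0 j - f nu (x nu) 0 j - \sum_k (u 0 k - x nu 0 k) * D nu k 0 j) <= e * r.
Hypothesis x_exponent : bounded_exponent x.

Let y := graph_map f x.

Let yl nu k : y nu 0 (lshift m k) = x nu 0 k. Proof. exact: row_mxEl. Qed.
Let yr nu j : y nu 0 (rshift d j) = f nu (x nu) 0 j. Proof. exact: row_mxEr. Qed.

Let y_int : ZS y.
Proof.
move=> nu i; case: (split_ordP i) => k ->; rewrite ?yl ?yr; first exact: hUint.
exact: hfint.
Qed.

Let A' := eps0 + A * \prod_(nu : S) q nu ^+ L.

Let qL_le (nu : S) : q nu ^+ L <= \prod_(nu : S) q nu ^+ L.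
Proof. by apply: (@le_prod_ge1 R _ (fun nu : S => q nu ^+ L)) => j; exact: exprn_ege1. Qed.

Let A_le : A <= A'.
Proof.
rewrite /A' -[leLHS]add0r lerD ?(ltW eps0_gt0) // ler_peMr ?(ltW A_gt0) //.
by apply: prod_ge1 => nu; exact: exprn_ege1.
Qed.
Let A'_gt0 : 0 < A'. Proof. exact: lt_le_trans A_gt0 A_le. Qed.

Let power_le (nu : S) (b : 'rV[int]_(d + m).+1) k j : b != 0 ->
  height R b `^ (- tau (lshift m k) nu) <= height R b `^ (- tau (rshift d j) nu).
Proof. by move=> b0; rewrite ler_powR ?height_ge1 // lerN2 hb. Qed.

Lemma tangent_approximant b : b != 0 ->
  (forall nu k, abs (err nu b k) <= A * height R b `^ (- tau (lshift m k) nu)) ->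
  (forall nu j, abs (err_tan nu b j) <= eps0 * height R b `^ (- tau (rshift d j) nu)) ->
  approximant tau y A' b.
Proof.
move=> b0 be bt; split=> // i nu; case: (split_ordP i) => [k|j] ->; rewrite ?yl ?yr.
  apply: le_trans (be nu k) _; by rewrite ler_wpM2r ?powR_ge0.
rewrite -(subrK (\sum_k err nu b k * D nu k 0 j) (_ - _)).
have H0 : 0 <= height R b `^ (- tau (rshift d j) nu) by exact: powR_ge0.
apply: padic_absD_le.
  apply: le_trans (bt nu j) _; rewrite ler_wpM2r // /A' lerDl mulr_ge0 ?(ltW A_gt0) //.
  by apply: prodr_ge0 => sigma _; rewrite exprn_ge0 // ltW.
apply: padic_abs_sum_le => [|k _]; first by rewrite mulr_ge0 // ltW.
rewrite padic_absM mulrC.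
apply: (@le_trans _ _ (q nu ^+ L * (A * height R b `^ (- tau (rshift d j) nu)))).
  rewrite ler_pM ?padic_abs_ge0 //; apply: le_trans (be nu k) _.
  by rewrite ler_pM2l // power_le.
rewrite mulrA ler_wpM2r // /A' mulrC -[leLHS]add0r lerD ?(ltW eps0_gt0) //.
by rewrite ler_pM2l.
Qed.

Lemma ratio_small nu r : 0 < r -> exists H0 : nat, forall b,
  approximant tau y A' b -> b 0 ord0 != 0 -> (H0 <= nat_height b)%N ->
  forall i, A' * height R b `^ (- tau i nu) <= r * abs ((b 0 ord0)%:~R : 'Q_[val nu]).
Proof.
move=> r0; have [tau_le1|tau_gt1] := pselect (exists i, tau i nu <= 1).
  have [w w_lt wE] := x_exponent tau_le1.
  have [H0 H0P] := ratio_exponent htau A'_gt0 y_int alpha_gt0 alpha_tau alpha_lt1 wE w_lt r0.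
  by exists H0 => b bA _; exact: H0P.
apply: ratio_gt1 => // i; rewrite ltNge; apply/negP => ti; apply: tau_gt1.
by exists i.
Qed.

(* With b as in [tangent_dirichlet], [c0] is the point b / b_0. *)
Lemma dilated_boxes s M N : (forall nu : S, q nu ^+ L.+1 * A * q nu ^- s < c) ->
  exists c0 t, [/\ box R c0 t x, box R c0 t `<=` box R x (fun _ _ => M) &
    box R c0 (fun i nu => t i nu + s)%N `<=` good_from N].
Proof.
move=> hs.
have /choice[M1 M1P] : forall nu, exists M, forall u, pball R (x nu) M u ->
    forall r, 0 <= r -> (forall k, abs (u 0 k - x nu 0 k) <= r) -> forall j,
      abs (f nu u 0 j - f nu (x nu) 0 j - \sum_k (u 0 k - x nu 0 k) * D nu k 0 j)
        <= c / 2%:R / A * r.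
  by move=> nu; apply: D_diff; rewrite !divr_gt0.
pose M' := maxn M (maxn L (\max_nu M1 nu)).
have /choice[H1 H1P] : forall nu : S, exists H0 : nat, forall b,
  approximant tau y A' b -> b 0 ord0 != 0 -> (H0 <= nat_height b)%N ->
  forall i, A' * height R b `^ (- tau i nu) <=
    q nu ^- M'.+1 * abs ((b 0 ord0)%:~R : 'Q_[val nu]).
  by move=> nu; apply: ratio_small; rewrite invr_gt0 exprn_gt0.
have [H2 H2P] := approximant_b0 y A'_gt0 hc.
have [b [bn0 be bt] bH] := (infinite_heightP _).1 tangent_dirichlet
  (maxn N (maxn H2 (\max_nu H1 nu))).
have bA := tangent_approximant bn0 be bt.
have b0 : b 0 ord0 != 0.
  by apply: H2P bA _; apply: leq_trans bH; rewrite !leq_max leqnn orbT.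
have b0p (nu : S) : ((b 0 ord0)%:~R : 'Q_[val nu]) != 0 by rewrite padic_int_neq0.
have b0a (nu : S) : 0 < abs ((b 0 ord0)%:~R : 'Q_[val nu]) by rewrite padic_abs_gt0.
pose rho (k : 'I_d) (nu : S) :=
  A * height R b `^ (- tau (lshift m k) nu) / abs ((b 0 ord0)%:~R : 'Q_[val nu]).
have Hb0 : 0 < height R b := lt_le_trans ltr01 (height_ge1 R bn0).
have rho0 k (nu : S) : 0 < rho k nu by rewrite divr_gt0 // mulr_gt0 // powR_gt0.
have rhoM k (nu : S) : q nu * rho k nu <= q nu ^- M'.
  have bH1 : (H1 nu <= nat_height b)%N.
    by apply: leq_trans bH; rewrite !leq_max leq_bigmax !orbT.
  have := H1P nu b bA b0 bH1 (lshift m k).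
  rewrite -ler_pdivrMr // => h.
  rewrite -ler_pdivlMl // mulrC -invfM -exprSr; apply: le_trans h.
  by rewrite /rho ler_pM2r ?invr_gt0 // ler_pM2r // powR_gt0.
have /choice[t0 t0P] : forall kn : 'I_d * S, exists t,
    q kn.2 ^- t <= q kn.2 * rho kn.1 kn.2 /\ q kn.2 * rho kn.1 kn.2 < q kn.2 ^- t * q kn.2.
  move=> [k nu] /=; apply: level_ex; first by apply: mulr_gt0; [exact: q_gt0|exact: rho0].
  apply: le_trans (rhoM k nu) _; rewrite invf_le1 ?exprn_gt0 //; exact: exprn_ege1.
pose t (k : 'I_d) (nu : S) := t0 (k, nu).
have t_up k (nu : S) : q nu ^- t k nu <= q nu * rho k nu by have [] := t0P (k, nu).
have t_low k (nu : S) : rho k nu <= q nu ^- t k nu.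
  by have [_] := t0P (k, nu); rewrite mulrC ltr_pM2r // => /ltW.
have tM k nu : (M' <= t k nu)%N.
  by rewrite -(le_expV R (val nu)); apply: le_trans (t_up k nu) (rhoM k nu).
pose c0 : QS S d := fun nu => \row_k ((b 0 (lift ord0 (lshift m k)))%:~R / (b 0 ord0)%:~R).
have xc (nu : S) k : x nu 0 k - c0 nu 0 k = err nu b k / (b 0 ord0)%:~R.
  by rewrite mxE /err mulrBl [_ * x nu 0 k]mulrC (mulfK (b0p nu)).
have xc_le (nu : S) k : abs (x nu 0 k - c0 nu 0 k) <= rho k nu.
  by rewrite xc padic_absM padic_absV /rho ler_pM2r ?invr_gt0.
have c0x : box R c0 t x by move=> k nu; exact: le_trans (xc_le nu k) (t_low k nu).
have c0_sub : box R c0 t `<=` box R x (fun _ _ => M').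
  by rewrite -(box_eq c0x); apply: box_sub => [|k nu]; [exact: boxxx|exact: tM].
exists c0, t; split=> //.
  by apply: subset_trans c0_sub _; apply: box_sub => *; [exact: boxxx|rewrite leq_maxl].
move=> z c0z; exists b; first by apply: leq_trans bH; rewrite leq_max leqnn.
have zt : box R c0 t z by apply: box_sub c0z => *; [exact: boxxx|exact: leq_addr].
have pb (nu : S) u M0 : box R c0 t u -> (M0 <= M')%N -> pball R (x nu) M0 (u nu).
  move=> /c0_sub xu M0M; apply: (pball_le M0M) => k; exact: xu.
have LM : (L <= M')%N by rewrite !leq_max leqnn orbT.
have z_le (nu : S) k C : height R b `^ (- tau (lshift m k) nu) <= C ->
    abs (z nu 0 k - c0 nu 0 k) <=
      q nu ^- s * q nu * A * C / abs ((b 0 ord0)%:~R : 'Q_[val nu]).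
  move=> hC; apply: le_trans (c0z k nu) _.
  rewrite exprD invfM mulrC -!mulrA ler_pM2l ?invr_gt0 ?exprn_gt0 //.
  apply: le_trans (t_up k nu) _; rewrite ler_pM2l // /rho !mulrA.
  by rewrite ler_pM2r ?invr_gt0 // ler_pM2l.
have lt_c (nu : S) C : 0 < C -> q nu ^- s * q nu * A * C * q nu ^+ L < c * C.
  move=> C0; rewrite [ltLHS](_ : _ = q nu ^+ L.+1 * A * q nu ^- s * C).
    by rewrite ltr_pM2r.
  by rewrite exprS; ring.
have nn (nu : S) C : 0 <= C -> 0 <= q nu ^- s * q nu * A * C.
  move=> C0; apply: mulr_ge0 => //; apply/ltW; rewrite mulr_gt0 // mulr_gt0 //.
  by rewrite invr_gt0 exprn_gt0.
split=> [nu|i nu].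
  by have [LU _] := Lx nu; apply: LU; exact: pb.
have Hp : 0 < height R b `^ (- tau i nu) by exact: powR_gt0.
move: Hp; case: (split_ordP i) => [k|j] -> Hp.
  rewrite row_mxEl.
  have -> : (b 0 ord0)%:~R * z nu 0 k - (b 0 (lift ord0 (lshift m k)))%:~R =
      (b 0 ord0)%:~R * (z nu 0 k - c0 nu 0 k).
    by rewrite mxE [RHS]mulrBr; congr (_ - _); rewrite mulrC (divfK (b0p nu)).
  rewrite padic_absM; apply: le_lt_trans (lt_c nu _ Hp).
  apply: (@le_trans _ _ (q nu ^- s * q nu * A * height R b `^ (- tau (lshift m k) nu))).
    by rewrite mulrC -ler_pdivlMr //; exact: z_le.
  rewrite ler_peMr //; last exact: exprn_ege1.
  by apply: nn; exact: ltW.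
rewrite row_mxEr; set C := height R b `^ _ in Hp *.
set B : 'Q_[val nu] := (b 0 ord0)%:~R.
have -> : B * f nu (z nu) 0 j - (b 0 (lift ord0 (rshift d j)))%:~R =
   B * (f nu (z nu) 0 j - f nu (c0 nu) 0 j) +
   B * (f nu (c0 nu) 0 j - f nu (x nu) 0 j - \sum_k (c0 nu 0 k - x nu 0 k) * D nu k 0 j) +
   err_tan nu b j.
  have E : B * (\sum_k (c0 nu 0 k - x nu 0 k) * D nu k 0 j) = - \sum_k err nu b k * D nu k 0 j.
    rewrite mulr_sumr -sumrN; apply: eq_bigr => k _.
    by rewrite -[c0 nu 0 k - _]opprB xc mulNr mulrN mulrA [B * _]mulrC (divfK (b0p nu)).
  rewrite /err_tan !mulrBr E opprK -/B; set s1 := \sum_k _.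
  have alg (K : comNzRingType) (u v w z0 t1 : K) :
    u - v = u - w + (w - z0 + t1) + (z0 - v - t1) by ring.
  exact: alg.
apply: padic_absD_lt; last first.
  by apply: le_lt_trans (bt nu j) _; rewrite ltr_pM2r.
apply: padic_absD_lt; rewrite padic_absM.
  have [_ Llip] := Lx nu.
  have := Llip (z nu) (c0 nu) (pb nu z L zt LM) (pb nu c0 L (boxxx _ _ _) LM)
    (q nu ^- s * q nu * A * C / abs B) _ (fun k => z_le nu k C (power_le nu k j bn0)) j.
  move=> h; apply: le_lt_trans (lt_c nu C Hp).
  rewrite mulrC -ler_pdivlMr //; apply: le_trans (h _) _.
    by apply: mulr_ge0; rewrite ?invr_ge0 ?padic_abs_ge0 // nn // ltW.
  by rewrite mulrC mulrAC.
have M1M : (M1 nu <= M')%N by rewrite !leq_max leq_bigmax !orbT.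
have r0 : 0 <= A * C / abs B by rewrite ltW // divr_gt0 // mulr_gt0.
have cx k : abs (c0 nu 0 k - x nu 0 k) <= A * C / abs B.
  rewrite padic_absBC; apply: le_trans (xc_le nu k) _.
  by rewrite ler_pM2r ?invr_gt0 // ler_pM2l // power_le.
have h := M1P nu (c0 nu) (pb nu c0 _ (boxxx _ _ _) M1M) _ r0 cx j.
apply: (@le_lt_trans _ _ (c / 2%:R * C)).
  rewrite mulrC -ler_pdivlMr //; apply: le_trans h _.
  have alg (u v w z0 : R) : v != 0 -> u / v * (v * w / z0) = u * w / z0.
    by move=> v0; rewrite !mulrA divfK.
  by rewrite alg // gt_eqF.
by rewrite ltr_pM2r // ltr_pdivrMr // ltr_pMr // ltr1n.
Qed.

End AtPoint.

Lemma lip_set_open : open lip_set.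
Proof.
apply/(open_QS R) => x Lx; exists L => z xz nu.
by apply: lip_at_ball (Lx nu) _ => k; exact: xz.
Qed.

Lemma lip_set_sub : lip_set `<=` domain_prod U.
Proof. by move=> x Lx nu; have [LU _] := Lx nu; apply: LU; exact: pballxx. Qed.

Lemma good_open b : open (good b).
Proof.
apply/(open_QS R) => x [Ux bx].
have /choice[l lP] : forall nu : S, exists l, lip_at R (U nu) (f nu) l (x nu).
  by move=> nu; apply: lip_at_ex.
have /choice[e eP] : forall k : 'I_(d + m) * S, exists M,
    q k.2 ^- M < c * height R b `^ (- tau k.1 k.2) / q k.2 ^+ l k.2.
  move=> [i nu]; apply: expV_small; apply: divr_gt0; last exact/exprn_gt0/q_gt0.
  exact: le_lt_trans (padic_abs_ge0 _ _) (bx i nu).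
pose M := maxn (\max_nu l nu) (\max_k e k).
exists M => z xz; have lM nu : (l nu <= M)%N by rewrite /M leq_max leq_bigmax.
have pb (nu : S) : pball R (x nu) (l nu) (z nu).
  by move=> k; apply: le_trans (xz k nu) _; rewrite le_expV.
split=> [nu|i nu]; first by have [lU _] := lP nu; apply: lU; exact: pb.
have qM : q nu ^+ l nu * q nu ^- M < c * height R b `^ (- tau i nu).
  rewrite mulrC -ltr_pdivlMr ?exprn_gt0 //; apply: le_lt_trans (eP (i, nu)).
  by rewrite le_expV /M leq_max (leq_bigmax (i, nu)) orbT.
have -> : (b 0 ord0)%:~R * graph_map f z nu 0 i - (b 0 (lift ord0 i))%:~R =
    (b 0 ord0)%:~R * (graph_map f z nu 0 i - graph_map f x nu 0 i) +
    ((b 0 ord0)%:~R * graph_map f x nu 0 i - (b 0 (lift ord0 i))%:~R).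
  by rewrite mulrBr addrA subrK.
apply: padic_absD_lt; last exact: bx.
apply: le_lt_trans qM; rewrite padic_absM -[leRHS]mul1r.
rewrite ler_pM ?padic_abs_ge0 ?padic_abs_int_le1 //.
case: (split_ordP i) => k ->.
  rewrite !row_mxEl; apply: le_trans (xz k nu) _.
  by rewrite ler_peMl ?invr_ge0 ?exprn_ge0 ?exprn_ege1 // ltW.
rewrite !row_mxEr; have [_ lip] := lP nu.
apply: lip; rewrite ?invr_ge0 ?exprn_ge0 ?(ltW (q_gt0 nu)) //.
  exact: pballxx.
Qed.

Lemma good_from_open N : open (good_from N).
Proof. by apply: bigcup_open => b _; exact: good_open. Qed.

Lemma W_good_from x : domain_prod U x ->
  W c tau (graph_map f x) <-> forall N, good_from N x.
Proof.
move=> Ux; rewrite /W /=; split=> [[_ /infinite_heightP h] N|h].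
  by have [b bx bN] := h N; exists b.
split.
  move=> nu i; case: (split_ordP i) => k ->; rewrite ?row_mxEl ?row_mxEr; first exact: hUint.
  exact: hfint.
by apply/infinite_heightP => N; have [b bN [_ bx]] := h N; exists b.
Qed.

Lemma dilation_ex : exists s, forall nu : S, q nu ^+ L.+1 * A * q nu ^- s < c.
Proof.
have qA0 (nu : S) : 0 < q nu ^+ L.+1 * A.
  by apply: mulr_gt0 => //; apply/exprn_gt0/q_gt0.
have /choice[s sP] : forall nu : S, exists s, q nu ^- s < c / (q nu ^+ L.+1 * A).
  by move=> nu; apply: expV_small; apply: divr_gt0.
exists (\max_nu s nu)%N => nu; rewrite mulrC -ltr_pdivlMr //.
by apply: le_lt_trans (sP nu); rewrite le_expV leq_bigmax.
Qed.

Lemma good_from_full (mu : {measure set (borelQS S d) -> \bar R}) N :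
  normalized_haar mu -> {ae mu, forall x, domain_prod U x -> bounded_exponent x} ->
  mu (lip_set `\` good_from N) = 0%E.
Proof.
move=> [mu_inv mu1] ae; have [s hs] := dilation_ex.
apply: (null_of_boxes (R := R) (s := s) mu_inv lip_set_open (good_from_open N) _ ae)
  => [|x M Lx _ nx].
  have ZSE : @ZS S d = box R (fun=> 0) (fun _ _ => 0%N) :> set (QS S d).
    apply/seteqP; split=> z zz.
      move=> i nu; rewrite mxE subr0 expr0 invr1.
      by rewrite padic_abs_le1; exact: zz.
    move=> nu i; have := zz i nu; rewrite mxE subr0 expr0 invr1.
    by rewrite padic_abs_le1.
  apply: (@le_lt_trans _ _ (mu (@ZS S d))); last by rewrite mu1 ltry.
  apply: le_measure; rewrite ?inE.
  - by apply: open_measurable_QS; exact: lip_set_open.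
  - by rewrite ZSE; apply: open_measurable_QS; exact: box_open.
  - by move=> z /lip_set_sub Uz nu i; exact: hUint.
have xe : bounded_exponent x.
  by move/contrapT : nx; apply; exact: lip_set_sub.
pose D (nu : S) := cid2 (lip_at_diff (@hUopen nu) (@hfC2 nu) (Lx nu)).
apply: (dilated_boxes Lx (D := fun nu => s2val (D nu)) _ _ xe M N hs).
  by move=> nu; case: (D nu).
by move=> nu; case: (D nu).
Qed.

End Key.

Lemma lip_set_cover (R : realType) (S : {fset primeNat}) (d m : nat)
  (U : forall nu : S, set 'rV['Q_[val nu]]_d)
  (f : forall nu : S, 'rV['Q_[val nu]]_d -> 'rV['Q_[val nu]]_m) x :
  (forall nu, open (U nu)) -> (forall nu, class_C 2 (U nu) (f nu)) ->
  domain_prod U x -> exists L, lip_set R U f L x.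
Proof.
move=> oU fC Ux.
have /choice[l lP] : forall nu : S, exists l, lip_at R (U nu) (f nu) l (x nu).
  by move=> nu; apply: lip_at_ex.
exists (\max_nu l nu)%N => nu; have [lU lip] := lP nu.
have lM : (l nu <= \max_nu l nu)%N by exact: leq_bigmax.
split; first exact: subset_trans (pball_le lM) lU.
move=> u v xu xv r r0 uv j.
apply: le_trans (lip u v (pball_le lM xu) (pball_le lM xv) r r0 uv j) _.
by rewrite ler_wpM2r // ler_weXn2l //; exact/ltW/prime_gt1R.
Qed.

Theorem theorem8p13 (R : realType) (S : {fset primeNat}) (hS : S != fset0)
  (d m : nat) (hd : (1 <= d)%N) (hm : (1 <= m)%N)
  (mu : {measure set (borelQS S d) -> \bar R}) (hmu : normalized_haar mu)
  (U : forall nu : S, set 'rV['Q_[val nu]]_d)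
  (hUopen : forall nu, open (U nu))
  (hUint : forall nu x, U nu x -> forall i, padic_norm (x 0 i) <= 1)
  (f : forall nu : S, 'rV['Q_[val nu]]_d -> 'rV['Q_[val nu]]_m)
  (hfint : forall nu x, U nu x -> forall j, padic_norm (f nu x 0 j) <= 1)
  (hfC2 : forall nu, class_C 2 (U nu) (f nu))
  (tau : 'I_(d + m) -> S -> R)
  (htau : forall i nu, 0 < tau i nu)
  (ha : \sum_i \sum_nu tau i nu = (d + m).+1%:R)
  (hb : forall nu (i : 'I_d) (j : 'I_m),
      tau (rshift d j) nu <= tau (lshift m i) nu)
  (hc : forall i, 1 < \sum_nu tau i nu)
  (halpha : exists alpha : R,
      [/\ 0 < alpha, (forall i nu, alpha < tau i nu), alpha < 1 &
          forall nu : S, (exists i, tau i nu <= 1) ->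
            (manifold_exponent f mu (domain_prod U)
               (shifted_weight tau nu alpha)
             < (1 + alpha / ((1 - alpha) * (d + m).+1%:R))%:E)%E]) :
  mu (domain_prod U `&` graph_map f @^-1` Bad tau) = 0%E.
Proof.
have [alpha [alpha0 alpha_tau alpha1 h_exp]] := halpha.
have FF := ae_filter_ringOfSetsType mu.
have ae : {ae mu, forall x, domain_prod U x -> bounded_exponent f tau alpha x}.
  suff : forall nu : S, {ae mu, forall x, domain_prod U x -> (exists i, tau i nu <= 1) ->
      exists2 w : R, w < 1 + alpha / ((1 - alpha) * (d + m).+1%:R) &
        (exponent (shifted_weight tau nu alpha) (graph_map f x) <= w%:E)%E}.
    move=> /(@filter_forall _ _ _ _ FF); apply: (@filterS _ _ FF) => x h Ux nu.
    exact: h.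
  move=> nu; have [tau1|ntau1] := pselect (exists i, tau i nu <= 1); last first.
    by apply: aeW => x _ /ntau1.
  have /ereal_inf_lt[_ [w w_ae <-]] := h_exp nu tau1; rewrite lte_fin => w_lt.
  by apply: (@filterS _ _ FF) w_ae => x h Ux _; exists w => //; exact: h.
pose V (c : R) N : set (borelQS S d) := good_from U f tau c N.
have mV c N : measurable (V c N).
  by apply: open_measurable_QS; exact: good_from_open.
have WV c x : domain_prod U x -> W c tau (graph_map f x) <-> forall N, V c N x.
  exact: W_good_from.
have mX : measurable (domain_prod U `&` graph_map f @^-1` Bad tau : set (borelQS S d)).
  have -> : domain_prod U `&` graph_map f @^-1` Bad tau =
      (domain_prod U `&` \bigcap_N V 1 N) `\` \bigcap_k \bigcap_N V k.+1%:R^-1 N.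
    apply/seteqP; split=> x.
      move=> [Ux [W1 nW]]; split; first by split=> // N _; exact: (WV _ _ Ux).1.
      by move=> Vx; apply: nW => k _; apply/(WV _ _ Ux) => N; exact: Vx.
    move=> [[Ux V1] nV]; split=> //; split; first by apply/(WV _ _ Ux) => N; exact: V1.
    by move=> Wx; apply: nV => k _ N _; exact: (WV _ _ Ux).1 (Wx k I) N.
  apply: measurableD; first apply: measurableI.
  - apply: open_measurable_QS; apply/(open_QS R) => x Ux.
    have [L Lx] := lip_set_cover R hUopen hfC2 Ux.
    have /(open_QS R) := @lip_set_open R S d m U f L => /(_ x Lx) [M ML].
    by exists M => z /ML; exact: lip_set_sub.
  - exact: bigcap_measurable.
  - by apply: bigcap_measurable => // k _; exact: bigcap_measurable.
apply/negligibleP => //.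
apply: (@negligibleS _ _ _ mu (\bigcup_k \bigcup_L \bigcup_N
    (lip_set R U f L `\` V k.+1%:R^-1 N))).
  move=> x [Ux [_ nW]]; have [k nWk] : exists k, ~ W k.+1%:R^-1 tau (graph_map f x).
    by apply: contrapT => nk; apply: nW => k _; apply: contrapT => ?; apply: nk; exists k.
  have [L Lx] := lip_set_cover R hUopen hfC2 Ux.
  have [N nVN] : exists N, ~ V k.+1%:R^-1 N x.
    apply: contrapT => nN; apply: nWk; apply/(WV _ _ Ux) => N.
    by apply: contrapT => ?; apply: nN; exists N.
  by exists k => //; exists L => //; exists N.
apply: negligible_bigcup => k; apply: negligible_bigcup => L.
apply: negligible_bigcup => N; apply/negligibleP.
  apply: measurableD => //; apply: open_measurable_QS; exact: lip_set_open.
apply: good_from_full ae => //.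
Qed.
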